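(* Let $\alpha>1$. For each $L\in\mathbb{N}$ (with $L\ge 1$) set $T_s=T_s(L)=L^{-\frac{\alpha}{\alpha+2}}$. Then for every compact set $D\subseteq \Pi^+$, $$\mathbb{P}\Big[\lim_{L\to\infty}\ \sup_{z\in D}\ \big|W^{(d)}_{\psi_\alpha}(\mathcal{N}_{L,T_s})(z)-W_{\psi_\alpha}(\mathcal{N})(z)\big|=0\Big]=1 .$$ Here $W_{\psi_\alpha}(\mathcal{N})$ is the continuous wavelet transform of complex white noise $\mathcal{N}$ and $W^{(d)}_{\psi_\alpha}(\mathcal{N}_{L,T_s})$ is the discretized wavelet transform of the discretization of the same noise $\mathcal{N}$, both as defined in the context.
   Context: Notation. $\Pi^+=\{x+iy: x\in\mathbb{R},\,y>0\}$ is the upper half-plane, and points are written $z=x+iy$. Cauchy wavelets. For $\alpha>1$, $\psi_\alpha$ is the function whose Fourier transform is $\widehat{\psi_\alpha}(\xi)=\xi^{\frac{\alpha-1}{2}}e^{-\xi}$ for $\xi\ge 0$ and $\widehat{\psi_\alpha}(\xi)=0$ for $\xi<0$. The normalization is such that $$\psi_\alpha(t)=\int_0^\infty \xi^{\frac{\alpha-1}{2}}e^{-\xi}e^{it\xi}\,d\xi=\frac{\Gamma(\frac{\alpha+1}{2})}{(1-it)^{\frac{\alpha+1}{2}}},\qquad t\in\mathbb{R}$$ (principal branch). Translation and dilation. $(\mathbf{T}_x s)(t)=s(t-x)$ for $x\in\mathbb{R}$ and $(\mathbf{D}_y s)(t)=y^{-1/2}s(t/y)$ for $y>0$; thus $\mathbf{T}_x\mathbf{D}_y\psi_\alpha(t)=y^{-1/2}\psi_\alpha\big(\tfrac{t-x}{y}\big)$.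 White noise. Let $\{a_n\}_{n\ge0}$ be independent standard complex Gaussian random variables (mean $0$, $\mathbb{E}|a_n|^2=1$) on a probability space $(\Omega,\mathcal{F},\mathbb{P})$, and let $\{e_n\}_{n\ge0}$ be an orthonormal basis of $L^2(\mathbb{R})$. For $s\in L^2(\mathbb{R})$ put $\mathcal{N}(s)=\sum_{n=0}^\infty a_n\langle s,e_n\rangle$, where the series converges in $L^2(\Omega,\mathcal{F},\mathbb{P})$ to a complex Gaussian variable of mean $0$ and variance $\|s\|^2$. Wavelet transform of white noise. For $z=x+iy\in\Pi^+$, $$W_{\psi_\alpha}(\mathcal{N})(z)=\mathcal{N}(\mathbf{T}_x\mathbf{D}_y\psi_\alpha)=\sum_{n=0}^\infty a_n\langle \mathbf{T}_x\mathbf{D}_y\psi_\alpha,e_n\rangle .$$ Almost surely this series converges locally uniformly in $z\in\Pi^+$, and $W_{\psi_\alpha}(\mathcal{N})$ denotes the resulting random function with continuous realizations. Discretization. For $L\in\mathbb{N}$, $T_s>0$ and $\ell\in\{-L+1,\dots,L\}$, let $\mathcal{N}_{L,T_s}[\ell]=\mathcal{N}(\mathbb{1}_{((\ell-1)T_s,\ell T_s)})$, where $\mathbb{1}_A$ is the indicator function of $A$. The discretized wavelet transform is $$W^{(d)}_{\psi_\alpha}(\mathcal{N}_{L,T_s})(z)=\sum_{\ell=-L+1}^{L}\mathcal{N}_{L,T_s}[\ell]\;\mathbf{T}_x\mathbf{D}_y\psi_\alpha(\ell T_s),\qquad z=x+iy\in\Pi^+ .$$ *)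

(* Defs.v *)
From mathcomp Require Import all_boot all_order all_algebra finmap.
From mathcomp Require Import complex.
From mathcomp Require Import all_classical all_reals all_analysis.

Set Implicit Arguments.
Unset Strict Implicit.
Unset Printing Implicit Defensive.

Import Order.TTheory GRing.Theory Num.Theory.
Import numFieldNormedType.Exports.

Local Open Scope classical_set_scope.
Local Open Scope complex_scope.
Local Open Scope ring_scope.

(* The modulus is the real-valued [Normc.normc], the norm of R[i] being valued
   in R[i]. Topology and sigma-algebra on R[i] are those of R * R, through
   [C2R2]. *)
Notation cmod := Normc.normc.

Definition C2R2 {R : realType} (z : R[i]) : R * R :=
  (complex.Re z, complex.Im z).

Definition cintegral {d} {T : measurableType d} {R : realType}
    (mu : {measure set T -> \bar R}) (D : set T) (f : T -> R[i]) : R[i] :=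
  (\int[mu]_(x in D) complex.Re (f x)) +i* (\int[mu]_(x in D) complex.Im (f x)).

Definition cmeasurable {d} {T : measurableType d} {R : realType}
    (f : T -> R[i]) : Prop :=
  measurable_fun [set: T] (C2R2 \o f).

(* Square-integrable functions are not identified up to null sets. *)
Definition L2 {R : realType} (f : R -> R[i]) : Prop :=
  cmeasurable f /\
  (\int[lebesgue_measure]_t ((cmod (f t)) ^+ 2)%:E < +oo)%E.

(* Linear in the first argument. *)
Definition inner {R : realType} (f g : R -> R[i]) : R[i] :=
  cintegral lebesgue_measure [set: R] (fun t => f t * conjc (g t)).

Definition orthonormal_basis {R : realType} (e : nat -> R -> R[i]) : Prop :=
  [/\ forall n, L2 (e n),
      forall m n, inner (e m) (e n) = (m == n)%:R
    & forall s, L2 s ->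
      (\int[lebesgue_measure]_t
        ((cmod (\sum_(k < n) inner s (e k) * e k t - s t)%R) ^+ 2)%:E)%E
      @[n --> \oo] --> 0%E].

(* Circularly symmetric: the real and imaginary parts are independent centred
   normal variables, each of variance 1/2. *)
Definition standard_complex_gaussian {d} {Om : measurableType d} {R : realType}
    (P : probability Om R) (X : Om -> R[i]) : Prop :=
  cmeasurable X /\
  forall A : set (R * R), measurable A ->
    P (X @^-1` (C2R2 @^-1` A)) =
    (normal_prob 0 (Num.sqrt 2^-1) \x normal_prob 0 (Num.sqrt 2^-1))%E A.

Definition mutually_independent {d} {Om : measurableType d} {R : realType}
    (P : probability Om R) (X : nat -> Om -> R[i]) : Prop :=
  forall (J : {fset nat}) (A : nat -> set (R * R)),
    (forall j, measurable (A j)) ->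
    P (\bigcap_(j in [set` J]) (X j @^-1` (C2R2 @^-1` A j))) =
    (\prod_(j <- J) P (X j @^-1` (C2R2 @^-1` A j)))%E.

Definition noise_sum {Om : Type} {R : realType} (a : nat -> Om -> R[i])
    (e : nat -> R -> R[i]) (n : nat) (s : R -> R[i]) (w : Om) : R[i] :=
  \sum_(k < n) a k w * inner s (e k).

(* N s is any version of the L^2(Om)-limit of the series, which determines it
   only up to almost sure equality. *)
Definition white_noise {d} {Om : measurableType d} {R : realType}
    (P : probability Om R) (a : nat -> Om -> R[i]) (e : nat -> R -> R[i])
    (N : (R -> R[i]) -> Om -> R[i]) : Prop :=
  forall s, L2 s ->
    cmeasurable (N s) /\
    (\int[P]_w ((cmod (noise_sum a e n s w - N s w)%R) ^+ 2)%:E)%E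
      @[n --> \oo] --> 0%E.

Definition cauchy_wavelet_hat {R : realType} (alpha xi : R) : R :=
  if 0 <= xi then xi `^ ((alpha - 1) / 2) * expR (- xi) else 0.

Definition cauchy_wavelet {R : realType} (alpha t : R) : R[i] :=
  cintegral lebesgue_measure `[0, +oo[%classic
    (fun xi => (cauchy_wavelet_hat alpha xi)%:C *
               (cos (t * xi) +i* sin (t * xi))).

Definition translate {R : realType} (x : R) (s : R -> R[i]) (t : R) : R[i] :=
  s (t - x).

Definition dilate {R : realType} (y : R) (s : R -> R[i]) (t : R) : R[i] :=
  (y `^ (- 2^-1))%:C * s (t / y).

(* The point x + iy is the pair (x, y). *)
Definition upper_half_plane {R : realType} : set (R * R) :=
  [set z | 0 < z.2].

Definition wavelet_atom {R : realType} (alpha : R) (z : R * R) : R -> R[i] :=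
  translate z.1 (dilate z.2 (cauchy_wavelet alpha)).

(* Supremum in [0, +oo]; the outer maximum gives 0 on the empty set, where
   [ereal_sup] is -oo. *)
Definition sup_cmod {T : Type} {R : realType} (D : set T) (f : T -> R[i]) :
    \bar R :=
  maxe 0%E (ereal_sup [set (cmod (f z))%:E | z in D]).

(* Locally uniform convergence is uniform convergence on compact sets. *)
Definition wavelet_transform_of_noise {d} {Om : measurableType d}
    {R : realType} (P : probability Om R) (a : nat -> Om -> R[i])
    (e : nat -> R -> R[i]) (alpha : R) (W : Om -> R * R -> R[i]) : Prop :=
  [/\ forall z, upper_half_plane z -> cmeasurable (W ^~ z),
      forall w, {within upper_half_plane, continuous (C2R2 \o W w)}
    & {ae P, forall w, forall K : set (R * R),
        compact K -> K `<=` upper_half_plane ->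
        sup_cmod K (fun z => noise_sum a e n (wavelet_atom alpha z) w - W w z)
          @[n --> \oo] --> 0%E}].

Definition discretized_noise {Om : Type} {R : realType}
    (N : (R -> R[i]) -> Om -> R[i]) (Ts : R) (l : int) : Om -> R[i] :=
  N (fun t => (\1_(`](l%:~R - 1) * Ts, l%:~R * Ts[%classic : set R) t)%:C).

(* The index l runs over -L + 1, ..., L as l = k - L + 1 with 0 <= k < 2L. *)
Definition discretized_wavelet_transform {Om : Type} {R : realType}
    (N : (R -> R[i]) -> Om -> R[i]) (alpha : R) (L : nat) (Ts : R) (w : Om)
    (z : R * R) : R[i] :=
  \sum_(k < L.*2) let l : int := k%:Z - L%:Z + 1 in
    discretized_noise N Ts l w * wavelet_atom alpha z (l%:~R * Ts).

(* Main.v *)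
(* Around z0 the atom expands as c * sum_k q^k g_k, where |q| <= 1/2 and the
   Taylor coefficients g_k do not depend on z, decay like 1/(1+|t|) and are
   Lipschitz, all uniformly in k. A supremum over a disc of the discretization
   error of the noise is thus controlled by the countably many Gaussian
   variables N(s_k), where s_k is the error made by the step function that
   approximates g_k. With T = L^(-alpha/(alpha+2)) the squared L^2 norm of s_k is
   O(L T^3 + 1/(L T)) = O(L^(-gamma)), gamma > 0; Gaussian moments of a high
   enough order are then O(L^-2), hence summable in L, which gives almost sure
   convergence on the disc. Finitely many discs cover D.

   N is only an L^2 limit, so it is not linear pathwise. The computation is
   therefore done on the partial sums noise_sum a e n, which are linear for every
   outcome. Fatou's lemma for the liminf in n then provides, for almost every
   outcome and every large L, infinitely many n for which the error is small, and
   W is recovered along them. *)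
From HB Require Import structures.
Require Import Defs.
From mathcomp Require Import all_boot all_order all_algebra.
From mathcomp Require Import complex.
From mathcomp Require Import all_classical all_reals all_analysis.
From mathcomp Require Import finmap.
From mathcomp Require Import measurable_realfun lebesgue_integral zify ring lra.
Set Implicit Arguments.
Unset Strict Implicit.
Unset Printing Implicit Defensive.
Import Order.TTheory GRing.Theory Num.Theory.
Import numFieldNormedType.Exports.
Local Open Scope classical_set_scope.
Local Open Scope complex_scope.
Local Open Scope ring_scope.

(** * Taylor estimates *)

(** Apart from a prefactor in y, the atom is the integral over u >= 0 of u^p exp(i u (t - conj z)),
    with p = (alpha - 1) / 2, hence a power series in conj(z - z0). Its k-th coefficient contains
    u^k; normalized by (b / 2)^k / k!, where b is the height of z0, this power becomes a term of the
    series of exp(b u / 2), which the factor exp(- b u) absorbs. That is why all estimates on the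
    coefficients are uniform in k. Decay in t comes from the oscillation of the integral and is of
    order 1 / |t|; the tail of the squared norm beyond L T is then of order 1 / (L T). The
    hypothesis alpha > 1 enters twice: p > 0 makes the integrand vanish at 0, and 1 - 3 alpha /
    (alpha + 2) < 0 makes L T^3 tend to 0. The supremum over a disc is never integrated. It is
    dominated, outcome by outcome, by a countable sum whose measurability is clear. *)

Lemma le_of_derive_le {R : realType} (f g f' g' : R -> R) (s : R) :
  0 <= s -> f 0 <= g 0 ->
  (forall x : R, 0 <= x -> is_derive x (1 : R) f (f' x)) ->
  (forall x : R, 0 <= x -> is_derive x (1 : R) g (g' x)) ->
  (forall x : R, 0 <= x -> f' x <= g' x) -> f s <= g s.
Proof.
move=> s0 fg0 df dg le'.
have dgf (x : R) : 0 <= x -> is_derive x (1 : R) (g - f) (g' x - f' x).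
  by move=> x0; have ? := df _ x0; have ? := dg _ x0; apply: is_deriveB.
have cont : {within `[0, s], continuous (g - f)}.
  apply: derivable_within_continuous => x; rewrite in_itv/= => /andP[x0 _].
  by have [] := dgf x x0.
have H : forall x : R, x \in `]0, s[ -> 0 <= x.
  by move=> x; rewrite in_itv/= => /andP[/ltW].
have : (g - f) 0 <= (g - f) s.
  apply: (ger0_derive1_ndecr _ _ cont) => // x /H x0; have dd := dgf x x0.
    by case: dd.
  by rewrite derive1E derive_val subr_ge0 le'.
by rewrite !fctE; lra.
Qed.

Lemma is_derive_sumf {R : realType} n (h : nat -> R -> R) (x : R) (dh : nat -> R) :
  (forall i, is_derive x (1 : R) (h i) (dh i)) ->
  is_derive x (1 : R) (fun y => \sum_(i < n) h i y) (\sum_(i < n) dh i).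
Proof.
move=> H.
rewrite (_ : (fun y => _) = \sum_(i < n) h i); last first.
  by apply/funext=> y; rewrite fct_sumE.
exact: is_derive_sum.
Qed.

Lemma is_derive_monom {R : realType} n (x : R) :
  is_derive x (1 : R) (fun y => y ^+ n.+1 / (n.+1)`!%:R) (x ^+ n / n`!%:R).
Proof.
have -> : (fun y : R => y ^+ n.+1 / (n.+1)`!%:R) = ((n.+1)`!%:R^-1) \*: (id ^+ n.+1).
  by apply/funext => y /=; rewrite mulrC fctE.
apply: is_derive_eq.
rewrite /GRing.scale/= factS natrM mulr1; field.
by rewrite addrC natr1 !pnatr_eq0 -lt0n fact_gt0.
Qed.

Lemma is_derive_mull {R : realType} (M x : R) : is_derive x (1 : R) ( *%R M) M.
Proof.
have := @is_deriveZ R R R id M x 1 1 (is_derive_id _ _).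
by rewrite /GRing.scale/= mulr1.
Qed.

(** The [F n] are the successive derivatives of [F 0]. Having the whole sequence as data lets the
    induction on [K] pass to [F \o S], with [B * M] for [B]: the derivative of the remainder of
    order [K.+1] is the remainder of order [K] of [F \o S]. *)
Lemma taylor_exp_bound {R : realType} (M : R) K : 0 <= M ->
  forall (B : R) (F : nat -> R -> R), 0 <= B ->
  (forall n (s : R), 0 <= s -> is_derive s (1 : R) (F n) (F n.+1 s)) ->
  (forall n (s : R), 0 <= s -> `|F n s| <= B * M ^+ n * expR (M * s)) ->
  forall s : R, 0 <= s ->
  `|F 0%N s - \sum_(k < K) F k 0 * (s ^+ k / k`!%:R)| <=
    B * M ^+ K * (s ^+ K / K`!%:R) * expR (M * s).
Proof.
move=> M0; elim: K => [|K IH] B F B0 dF bF s s0.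
  by rewrite big_ord0 subr0 fact0 divr1 expr0 !mulr1; have := bF 0%N s s0; rewrite expr0 mulr1.
pose r (F : nat -> R -> R) K s := F 0%N s - \sum_(k < K) F k 0 * (s ^+ k / k`!%:R).
pose b (s : R) := B * M ^+ K.+1 * (s ^+ K.+1 / (K.+1)`!%:R) * expR (M * s).
(* The first term is the bound of the induction hypothesis and the second is nonnegative, so [b']
   dominates the derivative of the remainder; [b] and the remainder both vanish at 0. *)
pose b' (s : R) := B * M ^+ K.+1 * (s ^+ K / K`!%:R) * expR (M * s) + b s * M.
have db (x : R) : is_derive x (1 : R) b (b' x).
  have -> : b = (B * M ^+ K.+1) \*: ((fun x => x ^+ K.+1 / (K.+1)`!%:R) * (expR \o ( *%R M))).
    by apply/funext => y; rewrite /b !fctE/= /GRing.scale/= !mulrA.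
  have ? := @is_derive_monom R K x.
  have ? : is_derive x (1 : R) ( *%R M) M.
    exact: is_derive_mull.
  have ? : is_derive x (1 : R) (expR \o ( *%R M)) (expR (M * x) * M).
    exact: is_derive1_comp.
  apply: is_derive_eq; rewrite /b' /b /GRing.scale/=; ring.
have dr (x : R) : 0 <= x -> is_derive x (1 : R) (r F K.+1) (r (F \o S) K x).
  move=> x0; have := dF 0%N _ x0.
  have : is_derive x (1 : R) (fun s => \sum_(k < K.+1) F k 0 * (s ^+ k / k`!%:R))
      (\sum_(k < K) F k.+1 0 * (x ^+ k / k`!%:R)).
    have -> : (fun s => \sum_(k < K.+1) F k 0 * (s ^+ k / k`!%:R)) =
       cst (F 0%N 0) + (fun s => \sum_(k < K) F k.+1 0 * (s ^+ k.+1 / (k.+1)`!%:R)).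
      by apply/funext => y; rewrite big_ord_recl expr0 fact0 divr1 mulr1.
    apply: is_derive_eq; last exact: add0r.
    apply: is_deriveD.
    apply: (@is_derive_sumf _ K (fun k s => F k.+1 0 * (s ^+ k.+1 / (k.+1)`!%:R)) x (fun k => F
      k.+1 0 * (x ^+ k / k`!%:R))) => i.
    exact: (@is_deriveZ R R R (fun s => s ^+ i.+1 / (i.+1)`!%:R) _ x 1 _ (is_derive_monom _ _)).
  by move=> ? ?; apply: is_deriveB.
have r0 : r F K.+1 0 = 0.
  rewrite /r big_ord_recl expr0 fact0 divr1 mulr1 big1 ?addr0 ?subrr// => i _.
  by rewrite /= expr0n mul0r mulr0.
have b0 : b 0 = 0 by rewrite /b expr0n /= mul0r mulr0 mul0r.
have rb (x : R) : 0 <= x -> `|r (F \o S) K x| <= b' x.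
  move=> x0; apply: (@le_trans _ _ (B * M ^+ K.+1 * (x ^+ K / K`!%:R) * expR (M * x))).
    have := IH (B * M) (F \o S) _ _ _ x x0.
    rewrite exprS !mulrA; apply => //; first exact: mulr_ge0.
    by move=> n y y0; rewrite -(mulrA B) -exprS; apply: bF.
  rewrite /b' lerDl /b; apply: mulr_ge0 => //; apply: mulr_ge0; last exact: expR_ge0.
  apply: mulr_ge0; first by apply: mulr_ge0 => //; exact: exprn_ge0.
  by apply: divr_ge0 => //; exact: exprn_ge0.
rewrite -/(r F K.+1 s) -/(b s) ler_norml; apply/andP; split.
  apply: (@le_of_derive_le _ (- b) (r F K.+1) (fun x => - b' x) (r (F \o S) K)) => //.
  - by rewrite fctE r0 b0 oppr0.
  - by move=> x x0; rewrite lerNl (le_trans _ (rb x x0))// -normrN ler_norm.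
apply: (@le_of_derive_le _ (r F K.+1) b (r (F \o S) K) b') => //.
- by rewrite r0 b0.
- by move=> x x0; rewrite (le_trans _ (rb x x0))// ler_norm.
Qed.

(** * Modulus and complex exponential *)

Section cmod_theory.
Context {R : realType}.
Implicit Types (x y z : R[i]) (r : R).

Lemma cmodE z : cmod z = Num.sqrt (complex.Re z ^+ 2 + complex.Im z ^+ 2).
Proof. by case: z. Qed.

Lemma cmod_ge0 z : 0 <= cmod z.
Proof. by rewrite cmodE sqrtr_ge0. Qed.

Lemma cmod_sqr z : cmod z ^+ 2 = complex.Re z ^+ 2 + complex.Im z ^+ 2.
Proof. by rewrite cmodE sqr_sqrtr// addr_ge0// sqr_ge0. Qed.

Lemma cmodD x y : cmod (x + y) <= cmod x + cmod y.
Proof. exact: le_normcD. Qed.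

Lemma cmodN x : cmod (- x) = cmod x.
Proof. exact: normcN. Qed.

Lemma cmod_real r : cmod r%:C = `|r|.
Proof. by rewrite cmodE/= expr0n/= addr0 sqrtr_sqr. Qed.

Lemma cmod_conj z : cmod (conjc z) = cmod z.
Proof. by case: z => a b /=; rewrite sqrrN. Qed.

Lemma cmod_exp z n : cmod (z ^+ n) = cmod z ^+ n.
Proof.
elim: n => [|n IH]; first by rewrite !expr0 Normc.normc1.
by rewrite !exprS Normc.normcM IH.
Qed.

Lemma normRe_le_cmod z : `|complex.Re z| <= cmod z.
Proof.
by rewrite cmodE -sqrtr_sqr ler_wsqrtr// lerDl sqr_ge0.
Qed.

Lemma normIm_le_cmod z : `|complex.Im z| <= cmod z.
Proof.
by rewrite cmodE -sqrtr_sqr ler_wsqrtr// lerDr sqr_ge0.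
Qed.

Lemma cmod_le_ReIm z : cmod z <= `|complex.Re z| + `|complex.Im z|.
Proof.
rewrite -(@ler_pXn2r _ 2%N) ?nnegrE ?cmod_ge0 ?addr_ge0// cmod_sqr sqrrD !real_normK ?num_real//.
have : 0 <= `|complex.Re z| * `|complex.Im z| by rewrite mulr_ge0.
lra.
Qed.

Lemma cmod_sum n (F : nat -> R[i]) :
  cmod (\sum_(k < n) F k) <= \sum_(k < n) cmod (F k).
Proof.
elim: n => [|n IH]; first by rewrite !big_ord0 Normc.normc0.
by rewrite !big_ord_recr/= (le_trans (cmodD _ _))// lerD2r.
Qed.

Lemma ReM x y :
  complex.Re (x * y) = complex.Re x * complex.Re y - complex.Im x * complex.Im y.
Proof. by case: x => a b; case: y. Qed.

Lemma ImM x y :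
  complex.Im (x * y) = complex.Re x * complex.Im y + complex.Im x * complex.Re y.
Proof. by case: x => a b; case: y. Qed.

Lemma ReD x y : complex.Re (x + y) = complex.Re x + complex.Re y.
Proof. by case: x; case: y. Qed.

Lemma ImD x y : complex.Im (x + y) = complex.Im x + complex.Im y.
Proof. by case: x; case: y. Qed.

Lemma ReN x : complex.Re (- x) = - complex.Re x.
Proof. by case: x. Qed.

Lemma ImN x : complex.Im (- x) = - complex.Im x.
Proof. by case: x. Qed.

Lemma Re_sum n (F : nat -> R[i]) :
  complex.Re (\sum_(k < n) F k) = \sum_(k < n) complex.Re (F k).
Proof.
by elim: n => [|n IH]; rewrite ?big_ord0// !big_ord_recr/= ReD IH.
Qed.

Lemma complexP x y :
  complex.Re x = complex.Re y -> complex.Im x = complex.Im y -> x = y.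
Proof. by case: x => a b; case: y => c d /= -> ->. Qed.

Definition cis r : R[i] := cos r +i* sin r.

Lemma cmod_cis r : cmod (cis r) = 1.
Proof. by rewrite cmodE/= cos2Dsin2 sqrtr1. Qed.

Lemma cisD r s : cis (r + s) = cis r * cis s.
Proof.
by apply: complexP; rewrite ?ReM ?ImM/= ?cosD ?sinD//; ring.
Qed.

Definition cexp z : R[i] := (expR (complex.Re z))%:C * cis (complex.Im z).

Lemma cmod_cexp z : cmod (cexp z) = expR (complex.Re z).
Proof.
by rewrite /cexp Normc.normcM cmod_real cmod_cis mulr1 ger0_norm// expR_ge0.
Qed.

(** The real Taylor bound is applied along the ray [s%:C * h], at [s = 1]. The multiplier [c] is
    there to be 1 or [- 'i], which gives the real and the imaginary part of the remainder. *)
Lemma cexp_taylor_Re (c h : R[i]) K :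
  `|complex.Re (c * (cexp h - \sum_(k < K) h ^+ k * (k`!%:R^-1)%:C))| <=
    cmod c * cmod h ^+ K / K`!%:R * expR (cmod h).
Proof.
pose F n s := complex.Re (c * h ^+ n * cexp (s%:C * h)).
have dF n (s : R) : 0 <= s -> is_derive s (1 : R) (F n) (F n.+1 s).
  move=> _; pose a := complex.Re h; pose b := complex.Im h.
  pose u := complex.Re (c * h ^+ n); pose v := complex.Im (c * h ^+ n).
  have FE : F n = (expR \o ( *%R a)) * (u \*: (cos \o ( *%R b)) - v \*: (sin \o ( *%R b))).
    apply/funext => x; rewrite /F /cexp ReM !fctE/= /GRing.scale/= -/u -/v /cis !(ReM,ImM)/= -/a
      -/b.
    by rewrite !mul0r !subr0 !addr0 (mulrC a) (mulrC b); ring.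
  have da := is_derive_mull a s; have db := is_derive_mull b s.
  have d1 : is_derive s (1 : R) (expR \o ( *%R a)) (expR (a * s) * a).
    exact: is_derive1_comp.
  have d2 : is_derive s (1 : R) (cos \o ( *%R b)) (- sin (b * s) * b).
    exact: is_derive1_comp.
  have d3 : is_derive s (1 : R) (sin \o ( *%R b)) (cos (b * s) * b).
    exact: is_derive1_comp.
  rewrite FE; apply: is_derive_eq.
  rewrite /F exprSr mulrA /cexp /cis !(ReM,ImM)/= -?ReM -?ImM -/u -/v -/a -/b.
  rewrite !(ReM,ImM)/= -/a -/b /GRing.scale/= !mul0r !subr0 !addr0 (mulrC s a) (mulrC s b).
  rewrite -(ReM c) -(ImM c) -/u -/v (_ : (_ \*: _ - _) s = u * cos (b * s) - v * sin (b * s))//.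
  ring.
have bF n (s : R) : 0 <= s -> `|F n s| <= cmod c * cmod h ^+ n * expR (cmod h * s).
  move=> s0; rewrite (le_trans (normRe_le_cmod _))// Normc.normcM cmod_cexp Normc.normcM cmod_exp.
  rewrite ler_wpM2l ?mulr_ge0 ?exprn_ge0 ?cmod_ge0// ler_expR ReM/= mul0r subr0 mulrC.
  by rewrite ler_wpM2r// (le_trans _ (normRe_le_cmod _))// ler_norm.
have := taylor_exp_bound K (cmod_ge0 h) (cmod_ge0 c) dF bF ler01.
rewrite expr1n mul1r (mulr1 (cmod h)); apply: le_trans.
rewrite le_eqVlt; apply/orP; left; apply/eqP; congr (`| _ |).
rewrite mulrBr ReD ReN {1}/F expr0 mulr1 mul1r; congr (_ - _).
rewrite mulr_sumr (Re_sum _ (fun k => c * (h ^+ k * (k`!%:R^-1)%:C))).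
apply: eq_bigr => k _; rewrite /F mul0r /cexp/= expR0 /cis cos0 sin0 mulrA expr1n mul1r.
by rewrite [LHS]ReM/= mulr0 subr0 !mulr1.
Qed.

Lemma cexp_taylor (h : R[i]) K :
  cmod (cexp h - \sum_(k < K) h ^+ k * (k`!%:R^-1)%:C) <=
    2 * (cmod h ^+ K / K`!%:R * expR (cmod h)).
Proof.
apply: (le_trans (cmod_le_ReIm _)); rewrite mulr2n mulrDl mul1r.
set z := (_ - _).
have -> : complex.Im z = complex.Re ((- 'i) * z).
  by rewrite ReM/= oppr0 mul0r sub0r mulN1r opprK.
have h1 := cexp_taylor_Re 1 h K; have h2 := cexp_taylor_Re (- 'i) h K.
apply: lerD.
  by move: h1; rewrite -/z mul1r Normc.normc1 mul1r.
apply: le_trans h2 _.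
rewrite -(mulrA (cmod _)) -(mulrA (cmod _)) ler_piMl//.
  by rewrite mulr_ge0 ?expR_ge0// divr_ge0 ?exprn_ge0 ?cmod_ge0.
by rewrite cmodE/= oppr0 expr0n/= add0r sqrrN expr1n sqrtr1.
Qed.

End cmod_theory.

(** * Complex-valued integrals *)

Section scaling.
Context {R : realType}.
Local Notation mu := (@lebesgue_measure R).
Local Notation Rp := (`[0%R, +oo[%classic : set R).

(** Both sides are measures in [A] that agree on half-open intervals, which determines Lebesgue
    measure. *)
Lemma lebesgue_measure_scale (y : R) (A : set R) : 0 < y -> measurable A ->
  mu A = (y%:E * mu ( *%R y @^-1` A))%E.
Proof.
move=> y0 mA.
have mf : measurable_fun setT ( *%R y : measurableTypeR R -> measurableTypeR R)
  by exact: mulrl_measurable.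
pose m : {measure set (measurableTypeR R) -> \bar R}
  := measure_function_mscale__canonical__measure_function_Measure (NngNum (ltW y0))
    (measure_function_pushforward__canonical__measure_function_Measure mu mf).
have := @lebesgue_measure_unique R m.
rewrite /m => -> //= X [[a b] _ <-]/=.
rewrite /mscale/= /pushforward.
have -> : *%R y @^-1` `]a, b]%classic = `](a / y), (b / y)]%classic.
  apply/seteqP; split => x /=; rewrite !in_itv/= ltr_pdivrMr// ler_pdivlMr// (mulrC x) //.
rewrite !lebesgue_measure_itv/= !lte_fin ltr_pM2r ?invr_gt0//.
case: ifPn => _; last by rewrite mule0.
by rewrite -!EFinB -EFinM -mulrBl mulrCA divff ?mulr1// gt_eqF.
Qed.

Lemma ge0_integral_scale (y : R) (f : R -> \bar R) : 0 < y ->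
  measurable_fun Rp f -> (forall x : R, 0 <= x -> (0 <= f x)%E) ->
  (\int[mu]_(x in Rp) f x = y%:E * \int[mu]_(x in Rp) f (y * x)%R)%E.
Proof.
move=> y0 mf f0.
have mM : measurable_fun setT ( *%R y : measurableTypeR R -> measurableTypeR R)
  by exact: mulrl_measurable.
pose m : {measure set (measurableTypeR R) -> \bar R}
  := measure_function_mscale__canonical__measure_function_Measure (NngNum (ltW y0))
    (measure_function_pushforward__canonical__measure_function_Measure mu mM).
have mRp : measurable (Rp : set (measurableTypeR R)) by exact: measurable_itv.
have f0' x : x \in Rp -> (0 <= f x)%E.
  by move=> /set_mem/=; rewrite in_itv/= andbT; exact: f0.
rewrite (@eq_measure_integral _ (measurableTypeR R) R Rp m); last first.
  by move=> A mA _; exact: (lebesgue_measure_scale y0 mA).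
rewrite ge0_integral_mscale//; last by move=> x xR; apply: f0'; exact: mem_set.
rewrite ge0_integral_pushforward//=; congr (_ * _)%E.
rewrite (_ : _ @^-1` _ = Rp)//.
by apply/seteqP; split => x /=; rewrite !in_itv/= !andbT pmulr_rge0.
Qed.

Lemma integrable_scale (y : R) (f : R -> R) : 0 < y ->
  mu.-integrable Rp (EFin \o f) -> mu.-integrable Rp (EFin \o (fun x => f (y * x))).
Proof.
move=> y0 intf; have mRp : measurable (Rp : set (measurableTypeR R)) by exact: measurable_itv.
have mf := measurable_int _ intf.
have mM : measurable_fun Rp ( *%R y : R -> R) by exact: mulrl_measurable.
have mfy : measurable_fun Rp (EFin \o (fun x => f (y * x))).
  apply: (@measurable_comp _ _ _ _ _ _ Rp) mf mM => //.
  by move=> _ [x /= + <-]; rewrite !in_itv/= !andbT pmulr_rge0.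
apply/integrableP; split => //.
move/integrableP : intf => [_]; rewrite (ge0_integral_scale y0)//=; last first.
  by apply/measurable_EFinP; apply: measurableT_comp => //; exact/measurable_EFinP.
by case: (integral _ _ _) => [r|/=|//]; rewrite ?ltry// gt0_muley ?lte_fin.
Qed.
Lemma Rintegral_scale (y : R) (f : R -> R) : 0 < y ->
  mu.-integrable Rp (EFin \o f) ->
  \int[mu]_(x in Rp) f x = y * \int[mu]_(x in Rp) f (y * x).
Proof.
move=> y0 intf; have mRp : measurable (Rp : set (measurableTypeR R)) by exact: measurable_itv.
have mf := measurable_int _ intf.
have intfy := integrable_scale y0 intf.
rewrite /Rintegral integralE [in RHS]integralE.
rewrite (ge0_integral_scale y0 (measurable_funepos mf)) => [|x _]; last exact: funepos_ge0.
rewrite (ge0_integral_scale y0 (measurable_funeneg mf)) => [|x _]; last exact: funeneg_ge0.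
have ip := integrable_pos_fin_num mRp intfy.
have ineg := integrable_neg_fin_num mRp intfy.
have H (A B : \bar R) : A \is a fin_num -> B \is a fin_num ->
    fine (y%:E * A - y%:E * B)%E = y * fine (A - B)%E.
  by case: A B => [r| |] [r'| |]//= _ _; rewrite mulrBr.
rewrite -(H _ _ ip ineg); congr (fine (_ * _ - _ * _))%E.
  by apply: eq_integral => x _; rewrite !funeposE.
by apply: eq_integral => x _; rewrite !funenegE.
Qed.

End scaling.

Section cintegral_theory.
Context {d} {T : measurableType d} {R : realType} (mu : {measure set T -> \bar R}).
Variable D : set T.
Hypothesis mD : measurable D.
Implicit Types f g : T -> R[i].

Definition cintegrable f :=
  mu.-integrable D (EFin \o (fun x => complex.Re (f x))) /\
  mu.-integrable D (EFin \o (fun x => complex.Im (f x))).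

Lemma cintegrable_dom f (phi : T -> R) :
  measurable_fun D (fun x => complex.Re (f x)) ->
  measurable_fun D (fun x => complex.Im (f x)) ->
  mu.-integrable D (EFin \o phi) ->
  (forall x, D x -> cmod (f x) <= phi x) -> cintegrable f.
Proof.
move=> mRe mIm iphi le; split; apply: le_integrable iphi => //;
  try exact/measurable_EFinP; move=> x Dx /=; rewrite lee_fin (le_trans _ (ler_norm _))//.
- exact: le_trans (normRe_le_cmod _) (le _ Dx).
- exact: le_trans (normIm_le_cmod _) (le _ Dx).
Qed.

Lemma cintegrableD f g : cintegrable f -> cintegrable g ->
  cintegrable (fun x => f x + g x).
Proof.
move=> [f1 f2] [g1 g2]; split.
  have := integrableD mD f1 g1; apply: eq_integrable => // x _ /=.
  by rewrite ReD EFinD.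
have := integrableD mD f2 g2; apply: eq_integrable => // x _ /=.
by rewrite ImD EFinD.
Qed.

Lemma cintegralD f g : cintegrable f -> cintegrable g ->
  cintegral mu D (fun x => f x + g x) = cintegral mu D f + cintegral mu D g.
Proof.
move=> [f1 f2] [g1 g2]; apply: complexP => /=.
  by rewrite -RintegralD//; apply: eq_Rintegral => x _; rewrite ReD.
by rewrite -RintegralD//; apply: eq_Rintegral => x _; rewrite ImD.
Qed.

Lemma cintegrableZ (c : R[i]) f : cintegrable f -> cintegrable (fun x => c * f x).
Proof.
move=> [f1 f2]; split.
  have := integrableB mD (integrableZl mD (complex.Re c) f1)
    (integrableZl mD (complex.Im c) f2).
  by apply: eq_integrable => // x _ /=; rewrite ReM.
have := integrableD mD (integrableZl mD (complex.Re c) f2)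
  (integrableZl mD (complex.Im c) f1).
by apply: eq_integrable => // x _ /=; rewrite ImM.
Qed.

Lemma cintegralZ (c : R[i]) f : cintegrable f ->
  cintegral mu D (fun x => c * f x) = c * cintegral mu D f.
Proof.
move=> [f1 f2]; apply: complexP => /=.
  rewrite ReM/= -!RintegralZl// -RintegralB//.
  - by apply: eq_Rintegral => x _; rewrite ReM.
  - exact: (integrableZl mD (complex.Re c) f1).
  - exact: (integrableZl mD (complex.Im c) f2).
rewrite ImM/= -!RintegralZl// -RintegralD//.
- by apply: eq_Rintegral => x _; rewrite ImM.
- exact: (integrableZl mD (complex.Re c) f2).
- exact: (integrableZl mD (complex.Im c) f1).
Qed.

Lemma eq_cintegral f g : (forall x, D x -> f x = g x) ->
  cintegral mu D f = cintegral mu D g.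
Proof.
by move=> fg; congr (_ +i* _); apply: eq_Rintegral => x /set_mem/fg ->.
Qed.

Lemma cintegral_sum n (F : nat -> T -> R[i]) : (forall k, cintegrable (F k)) ->
  cintegrable (fun x => \sum_(k < n) F k x) /\
  cintegral mu D (fun x => \sum_(k < n) F k x) = \sum_(k < n) cintegral mu D (F k).
Proof.
move=> iF; elim: n => [|n [IH1 IH2]].
  rewrite big_ord0 (_ : (fun x => _) = cst 0); last first.
    by apply/funext => x; rewrite big_ord0.
  split; first by split; apply: integrable0.
  by rewrite /cintegral /Rintegral/= integral0.
rewrite big_ord_recr/= (_ : (fun x => _) = fun x => \sum_(k < n) F k x + F n x); last first.
  by apply/funext => x; rewrite big_ord_recr.
by split; [exact: cintegrableD|rewrite cintegralD// IH2].
Qed.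

(** The factor 2 comes from bounding the real and imaginary parts separately; it reappears in most
    constants below. *)
Lemma cmod_cintegral_le f (phi : T -> R) : cintegrable f ->
  mu.-integrable D (EFin \o phi) ->
  (forall x, D x -> cmod (f x) <= phi x) ->
  cmod (cintegral mu D f) <= 2 * \int[mu]_(x in D) phi x.
Proof.
move=> [f1 f2] iphi le; rewrite mulr2n mulrDl mul1r (le_trans (cmod_le_ReIm _))//=.
have H (h : T -> R) : mu.-integrable D (EFin \o h) ->
    (forall x, D x -> `|h x| <= phi x) ->
    `|\int[mu]_(x in D) h x| <= \int[mu]_(x in D) phi x.
  move=> ih leh; apply: (le_trans (le_normr_Rintegral mD ih)).
  apply: le_Rintegral => //.
  exact: integrable_norm ih.
apply: lerD; apply: H => // x Dx.
- exact: le_trans (normRe_le_cmod _) (le _ Dx).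
- exact: le_trans (normIm_le_cmod _) (le _ Dx).
Qed.
End cintegral_theory.

(** * Expansion of the Cauchy wavelet *)

Section exponential_bounds.
Context {R : realType}.
Local Notation mu := (@lebesgue_measure R).
Local Notation Rp := (`[0%R, +oo[%classic : set (measurableTypeR R)).

Lemma expr_fact_le_expR (x : R) n : 0 <= x -> x ^+ n / n`!%:R <= expR x.
Proof.
move=> x0; case: n => [|n].
  by rewrite expr0 fact0 divr1 -expR0 ler_expR.
by rewrite (le_trans _ (expR_ge1Dxn n x0))// lerDr.
Qed.

(** For n >= p, (1 + x)^(n + 1) is at most a multiple of one term of the series of exp(c (1 + x)),
    whence the factor [expR c] in the witness. The factor [1 + x] is kept so that an extra power of
    [x] can be absorbed in the Lipschitz estimate of the coefficients. *)
Lemma powR_le_expR (p c : R) : 0 <= p -> 0 < c ->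
  exists2 C : R, 0 < C & forall x : R, 0 <= x -> (1 + x) * x `^ p <= C * expR (c * x).
Proof.
move=> p0 c0; pose n := Num.Def.archi_bound p.
have pn : p <= n%:R by exact/ltW/archi_boundP.
exists ((n.+1)`!%:R / c ^+ n.+1 * expR c).
  by rewrite mulr_gt0 ?expR_gt0// divr_gt0 ?exprn_gt0// ltr0n fact_gt0.
move=> x x0; have x1 : 0 <= 1 + x by rewrite addr_ge0.
apply: (@le_trans _ _ ((1 + x) ^+ n.+1)).
  rewrite exprS ler_wpM2l//.
  apply: (@le_trans _ _ ((1 + x) `^ p)).
    by rewrite ge0_ler_powR ?nnegrE// lerDr.
  by rewrite -powR_mulrn// ler_powR// lerDl.
have := @expr_fact_le_expR (c * (1 + x)) n.+1 (mulr_ge0 (ltW c0) x1).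
rewrite ler_pdivrMr ?ltr0n ?fact_gt0// exprMn mulrDr mulr1 expRD => H.
rewrite -(ler_pM2l (exprn_gt0 n.+1 c0)) (le_trans H)//.
rewrite le_eqVlt; apply/orP; left; apply/eqP; field.
by rewrite expf_neq0// gt_eqF.
Qed.

Lemma integrable_expRN (b : R) : 0 < b ->
  mu.-integrable Rp (EFin \o (fun x => expR (- b * x))).
Proof.
move=> b0; have mRp : measurable Rp by exact: measurable_itv.
have := @integrable_exponential_pdf R b b0.
move/(integrableS measurableT mRp (@subsetT _ _))/(integrableZl mRp b^-1).
apply: eq_integrable => // x xRp /=.
by rewrite /exponential_pdf patchE xRp/= -EFinM mulrA mulVf ?mul1r// gt_eqF.
Qed.

Lemma integrable_le_expRN (b C : R) (f : R -> R) : 0 < b ->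
  measurable_fun Rp f -> (forall x, 0 <= x -> `|f x| <= C * expR (- b * x)) ->
  mu.-integrable Rp (EFin \o f).
Proof.
move=> b0 mf le; have mRp : measurable Rp by exact: measurable_itv.
apply: le_integrable (integrableZl mRp C (integrable_expRN b0)) => //.
  exact/measurable_EFinP.
move=> x /=; rewrite in_itv/= andbT => x0.
by rewrite lee_fin (le_trans (le _ x0))// ler_norm.
Qed.

Lemma Rintegral_le_expRN (b C : R) (f : R -> R) : 0 < b ->
  measurable_fun Rp f -> (forall x, 0 <= x -> `|f x| <= C * expR (- b * x)) ->
  \int[mu]_(x in Rp) f x <= C * \int[mu]_(x in Rp) expR (- b * x).
Proof.
move=> b0 mf le; have mRp : measurable Rp by exact: measurable_itv.
have iE := integrable_expRN b0.
rewrite -RintegralZl//; apply: le_Rintegral => //.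
- exact: integrable_le_expRN le.
- exact: integrableZl iE.
- move=> x /=; rewrite in_itv/= andbT => x0.
  by rewrite (le_trans (ler_norm _))// le.
Qed.

Lemma cos_lip (a b : R) : `|cos a - cos b| <= `|a - b|.
Proof.
wlog ab : a b / b <= a => [H|].
  by have [/H//|/ltW/H] := leP b a; rewrite distrC (distrC a).
have [c _ ->] := @MVT_segment R cos (fun x => - sin x) b a ab
  (fun x _ => is_derive_cos x) (continuous_subspaceT (@continuous_cos R)).
rewrite normrM normrN ler_piMl// ler_norml sin_geN1 sin_le1//.
Qed.

Lemma sin_lip (a b : R) : `|sin a - sin b| <= `|a - b|.
Proof.
wlog ab : a b / b <= a => [H|].
  by have [/H//|/ltW/H] := leP b a; rewrite distrC (distrC a).
have [c _ ->] := @MVT_segment R sin cos b a ab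
  (fun x _ => is_derive_sin x) (continuous_subspaceT (@continuous_sin R)).
rewrite normrM ler_piMl// ler_norml cos_geN1 cos_le1//.
Qed.

Lemma cis_lip (a b : R) : cmod (cis a - cis b) <= 2 * `|a - b|.
Proof.
rewrite (le_trans (cmod_le_ReIm _))// mulr2n mulrDl mul1r.
by rewrite lerD// ?ReD ?ImD ?ReN ?ImN/= ?cos_lip ?sin_lip.
Qed.

(* Integrates the derivative of [phi * (1 + sin (s * x + th))]: since
   [phi' >= - b * phi] and [1 + sin >= 0], no bound on [phi'], which is singular
   at 0 when [p < 1], is needed. *)
Lemma Rintegral_cos_bound (p b s th d A : R) (phi : R -> R) :
  0 <= p -> 0 < b -> 0 < d -> d < A ->
  phi = (fun x => x `^ p * expR (- b * x)) ->
  s * \int[mu]_(x in `[d, A]) (phi x * cos (s * x + th)) <=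
    2 * phi A + 2 * b * \int[mu]_(x in `[d, A]) phi x.
Proof.
move=> p0 b0 d0 dA phiE.
pose dphi (x : R) := p * x `^ (p - 1) * expR (- b * x) - b * phi x.
have dphiE (x : R) : 0 < x -> is_derive x (1 : R) phi (dphi x).
  move=> x0; have d1 := is_derive1_powR p x0.
  have d2 := is_derive_mull (- b) x.
  have d3 : is_derive x (1 : R) (expR \o ( *%R (- b))) (expR (- b * x) * - b).
    exact: is_derive1_comp.
  have -> : phi = (@powR R ^~ p) * (expR \o ( *%R (- b))) by rewrite phiE.
  by apply: is_derive_eq; rewrite /dphi phiE /GRing.scale/=; ring.
have dsin (x : R) : is_derive x (1 : R) (fun x => sin (s * x + th)) (s * cos (s * x + th)).
  have d2 := is_derive_mull s x.
  have d3 : is_derive x (1 : R) (( *%R s) + cst th) s.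
    by apply: is_derive_eq; rewrite ?addr0.
  have -> : (fun x => sin (s * x + th)) = sin \o (( *%R s) + cst th) by [].
  have := @is_derive1_comp R sin (( *%R s) + cst th) x _ s (is_derive_sin _) d3.
  by rewrite mulrC.
pose F := phi * (fun x => 1 + sin (s * x + th)).
pose f (x : R) := dphi x * (1 + sin (s * x + th)) + s * (phi x * cos (s * x + th)).
have dF (x : R) : 0 < x -> is_derive x (1 : R) F (f x).
  move=> x0; have d1 := dphiE x x0; have d2 := dsin x.
  have d3 : is_derive x (1 : R) (fun x => 1 + sin (s * x + th)) (s * cos (s * x + th)).
    rewrite (_ : (fun x => _) = cst 1 + (fun x => sin (s * x + th)))//.
    by apply: is_derive_eq; rewrite ?add0r.
  by apply: is_derive_eq; rewrite /f /GRing.scale/=; ring.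
have pos (x : R) : x \in `[d, A] -> 0 < x.
  by rewrite in_itv/= => /andP[/(lt_le_trans d0)].
have cpow q (x : R) : 0 < x -> {for x, continuous (@powR R ^~ q)}.
  move=> x0; have [dx _] := is_derive1_powR q x0.
  by apply: differentiable_continuous; exact/derivable1_diffP.
have cphi (x : R) : 0 < x -> {for x, continuous phi}.
  move=> /dphiE[dx _].
  by apply: differentiable_continuous; exact/derivable1_diffP.
have csin (x : R) : {for x, continuous (fun x => sin (s * x + th))}.
  have [dx _] := dsin x.
  by apply: differentiable_continuous; exact/derivable1_diffP.
have ccos (x : R) : {for x, continuous (fun x => cos (s * x + th))}.
  apply: (@continuous_comp _ _ _ (fun x => s * x + th) cos); last exact: continuous_cos.
  by apply: cvgD; [apply: cvgMr; exact: cvg_id|exact: cvg_cst].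
have cE (x : R) : {for x, continuous (fun x => expR (- b * x))}.
  apply: (@continuous_comp _ _ _ (fun x => - b * x) expR); last exact: continuous_expR.
  by apply: cvgMr; exact: cvg_id.
have cf (x : R) : 0 < x -> {for x, continuous f}.
  move=> x0; apply: cvgD.
    apply: cvgM; last by apply: cvgD; [exact: cvg_cst|exact: csin].
    apply: cvgB; last by apply: cvgMr; exact: cphi.
    apply: cvgM; last exact: cE.
    by apply: cvgMr; exact: cpow.
  by apply: cvgMr; apply: cvgM; [exact: cphi|exact: ccos].
have within (h : R -> R) : (forall x : R, 0 < x -> {for x, continuous h}) ->
    {within `[d, A], continuous h}.
  by move=> ch; apply: continuous_in_subspaceT => x /set_mem/pos /ch.
have int (h : R -> R) : (forall x : R, 0 < x -> {for x, continuous h}) ->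
    mu.-integrable `[d, A] (EFin \o h).
  move=> ch; apply: continuous_compact_integrable; first exact: segment_compact.
  exact: within.
have FTC : \int[mu]_(x in `[d, A]) f x = F A - F d.
  rewrite /Rintegral (@continuous_FTC2 R f F d A dA (within _ cf))//.
    have cF (x : R) : 0 < x -> {for x, continuous F}.
      by move=> /dF[dx _]; apply: differentiable_continuous; exact/derivable1_diffP.
    split.
    - by move=> x; rewrite in_itv/= => /andP[/(lt_trans d0)/dF[]].
    - by apply: cvg_at_right_filter; exact: cF.
    - by apply: cvg_at_left_filter; apply: cF; exact: lt_trans dA.
  move=> x; rewrite in_itv/= => /andP[/(lt_trans d0)/dF ? _].
  by rewrite derive1E derive_val.
have mI : measurable (`[d, A]%classic : set (measurableTypeR R)) by exact: measurable_itv.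
rewrite -RintegralZl//; last first.
  apply: int => x x0; apply: cvgM; [exact: cphi|exact: ccos].
have phi0 (x : R) : 0 <= phi x by rewrite phiE mulr_ge0 ?powR_ge0 ?expR_ge0.
apply: (@le_trans _ _ (\int[mu]_(x in `[d, A]) (f x + 2 * b * phi x))).
  apply: le_Rintegral => //.
  - by apply: int => x x0; apply: cvgMr; apply: cvgM; [exact: cphi|exact: ccos].
  - by apply: int => x x0; apply: cvgD; [exact: cf|apply: cvgMr; exact: cphi].
  - move=> x xI; have x0 := pos _ xI.
    have : dphi x * (1 + sin (s * x + th)) >= - (2 * b * phi x).
      have : 0 <= p * x `^ (p - 1) * expR (- b * x).
        by rewrite !mulr_ge0 ?powR_ge0 ?expR_ge0.
      rewrite /dphi; have := phi0 x; have := sin_geN1 (s * x + th); have := sin_le1 (s * x + th).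
      set u := sin _; set w := _ * expR _; set v := phi x => u1 uN1 v0 w0.
      have : 0 <= b * v * (1 - u) by rewrite mulr_ge0 ?subr_ge0// mulr_ge0// ltW.
      have : 0 <= w * (1 + u) by rewrite mulr_ge0//; lra.
      nra.
    rewrite /f; lra.
rewrite RintegralD//; last 2 first.
- exact: int.
- by apply: int => x x0; apply: cvgMr; exact: cphi.
rewrite FTC RintegralZl//; last exact: int.
rewrite lerD2r /F !fctE.
have A0 : 0 <= phi d * (1 + sin (s * d + th)).
  by rewrite mulr_ge0//; have := sin_geN1 (s * d + th); lra.
have : phi A * (1 + sin (s * A + th)) <= phi A * 2.
  by rewrite ler_wpM2l//; have := sin_le1 (s * A + th); lra.
lra.
Qed.
End exponential_bounds.

(** * Decay of oscillatory integrals *)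

Section decay.
Context {R : realType}.
Local Notation mu := (@lebesgue_measure R).
Local Notation Rp := (`[0%R, +oo[%classic : set (measurableTypeR R)).

(** [Rintegral_cos_bound] stays away from 0 and from infinity; dominated convergence then reaches
    the half-line. The point 0 lies in none of the intervals, hence [g 0 = 0]; the index [n.+2]
    keeps the left endpoint below the right one. *)
Lemma cvg_Rintegral_exhaust (g : R -> R) : mu.-integrable Rp (EFin \o g) ->
  g 0 = 0 ->
  \int[mu]_(x in `[n.+2%:R^-1, n.+2%:R]) g x @[n --> \oo] --> \int[mu]_(x in Rp) g x.
Proof.
move=> ig g0; have mRp : measurable Rp by exact: measurable_itv.
pose J n : set (measurableTypeR R) := `[n.+2%:R^-1, n.+2%:R]%classic.
have mJ n : measurable (J n) by exact: measurable_itv.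
have JE n : Rp `&` J n = J n.
  apply/setIidr => x; rewrite /J/= !in_itv/= andbT => /andP[+ _].
  by apply: le_trans; rewrite invr_ge0.
have ifin : (\int[mu]_(x in Rp) (g x)%:E)%E \is a fin_num by exact: integrable_fin_num.
rewrite /Rintegral; apply: fine_cvg; rewrite fineK//.
under eq_fun do rewrite -[X in integral _ X _]JE integral_mkcondr.
apply: (@dominated_cvg _ _ _ mu Rp mRp _ _ (fun x => `|g x|%:E)) => //.
- move=> n; apply/measurable_restrict => //; rewrite JE.
  apply: measurable_funS (measurable_int _ ig) => //.
  by rewrite -[X in X `<=` _](JE n).
- move=> x; rewrite /= in_itv/= andbT le_eqVlt => /orP[/eqP <-|x0].
    rewrite g0; apply: cvg_near_cst; apply: nearW => n.
    rewrite patchE ifF//; apply/negbTE/negP => /set_mem.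
    by rewrite /J/= in_itv/= invr_le0 lern0.
  apply: cvg_near_cst.
  near=> n; rewrite patchE ifT//; apply/mem_set; rewrite /J/= in_itv/=.
  have h m : (Num.Def.archi_bound x <= m)%N -> x <= m%:R.
    move=> h; rewrite (le_trans (ltW (archi_boundP (ltW x0))))// ler_nat//.
  have h' m : (Num.Def.archi_bound x^-1 <= m)%N -> x^-1 <= m%:R.
    move=> h'; rewrite (@le_trans _ _ ((Num.Def.archi_bound x^-1)%:R))//.
      by rewrite ltW// archi_boundP// invr_ge0 ltW.
    by rewrite ler_nat.
  apply/andP; split.
    rewrite -[x]invrK lef_pV2 ?posrE ?invr_gt0//; apply: h'.
    by near: n; exists (Num.Def.archi_bound x^-1) => // k /= /leq_trans; apply;
      rewrite -addn2 leq_addr.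
  apply: h.
  by near: n; exists (Num.Def.archi_bound x) => // k /= /leq_trans; apply; rewrite -addn2 leq_addr.
- have := integrable_norm ig.
  by apply: eq_integrable.
- by move=> n x _; rewrite patchE; case: ifPn => // _; rewrite abse0 lee_fin.
Unshelve. all: by end_near.
Qed.

(** [B] bounds the boundary term at the right endpoint, wherever that endpoint is. The phase [th]
    lets one statement serve both cosine and sine. *)
Lemma Rintegral_cos_decay (p b s th B : R) (phi : R -> R) : 0 < p -> 0 < b ->
  phi = (fun x => x `^ p * expR (- b * x)) ->
  mu.-integrable Rp (EFin \o phi) -> (forall x : R, 0 <= x -> phi x <= B) ->
  `|s| * `|\int[mu]_(x in Rp) (phi x * cos (s * x + th))| <=
  2 * B + 2 * b * \int[mu]_(x in Rp) phi x.
Proof.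
move=> p0 b0 phiE iphi phiB; have mRp : measurable Rp by exact: measurable_itv.
have phi0 (x : R) : 0 <= phi x by rewrite phiE mulr_ge0 ?powR_ge0 ?expR_ge0.
rewrite -normrM.
have H u v : u * \int[mu]_(x in Rp) (phi x * cos (u * x + v)) <=
    2 * B + 2 * b * \int[mu]_(x in Rp) phi x.
  have mc : measurable_fun Rp (fun x => cos (u * x + v)).
    apply: measurable_funS (subsetT _) _ => //.
    apply: continuous_measurable_fun => x.
    apply: (@continuous_comp _ _ _ (fun x => u * x + v) cos); last exact: continuous_cos.
    by apply: cvgD; [apply: cvgMr; exact: cvg_id|exact: cvg_cst].
  have iphic : mu.-integrable Rp (EFin \o (fun x => phi x * cos (u * x + v))).
    apply: (le_integrable _ _ _ iphi) => //.
      apply/measurable_EFinP; apply: measurable_funM => //.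
      by apply/measurable_EFinP; exact: measurable_int iphi.
    move=> x _ /=; rewrite lee_fin normrM ger0_norm// ler_piMr//.
    by rewrite ler_norml cos_geN1 cos_le1.
  apply: (@cvgr_to_le _ \oo _ R (fun n => u * \int[mu]_(x in `[n.+2%:R^-1, n.+2%:R]) (phi x * cos
    (u * x + v)))).
    apply: cvgMr; apply: cvg_Rintegral_exhaust => //.
    by rewrite phiE powR0 ?mul0r// gt_eqF.
  apply: nearW => n.
  have sub : `[n.+2%:R^-1, n.+2%:R]%classic `<=` Rp.
    move=> x; rewrite /= !in_itv/= andbT => /andP[+ _].
    by apply: le_trans; rewrite invr_ge0.
  have := @Rintegral_cos_bound R p b u v n.+2%:R^-1 n.+2%:R phi (ltW p0) b0.
  have n1 : (n.+2%:R^-1 : R) < n.+2%:R.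
    by rewrite (@lt_trans _ _ 1)// ?ltr1n// invf_lt1 ?ltr0n// ltr1n.
  rewrite invr_gt0 ltr0n => /(_ isT n1 phiE) /le_trans; apply;
    rewrite lerD ?ler_wpM2l ?mulr_ge0 ?(ltW b0)//.
      by rewrite phiB.
    rewrite /Rintegral fine_le//.
    - apply: integrable_fin_num; first exact: measurable_itv.
      exact: integrableS iphi.
    - exact: integrable_fin_num.
    - apply: ge0_subset_integral => //.
      + exact: measurable_int iphi.
      + by move=> x _; rewrite lee_fin.
(* The lower bound is the upper bound for [- s] and [- th], since the cosine is even. *)
rewrite ler_norml H andbT lerNl -mulNr.
have := H (- s) (- th); congr (_ <= _); congr (_ * _).
by apply: eq_Rintegral => x _; rewrite mulNr -opprD cosN.
Qed.
End decay.

(** * Taylor coefficients of the atom *)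

Section wavelet_taylor.
Context {R : realType}.
Local Notation mu := (@lebesgue_measure R).
Local Notation Rp := (`[0%R, +oo[%classic : set (measurableTypeR R)).
Variables (p b x0 : R).
Hypotheses (p0 : 0 < p) (b0 : 0 < b).

Let mRp : measurable Rp. Proof. exact: measurable_itv. Qed.

Let RpP x : Rp x -> 0 <= x. Proof. by rewrite /= in_itv/= andbT. Qed.

(* [taylor_coef k] is the coefficient of [q ^+ k] in the expansion around
   [x0 + i b] of [(x, y) |-> \int u^p exp(- y u) cis((t - x) u) du], where
   [q = (2 / b) * ((b - y) +i* (x0 - x))]. *)
Definition taylor_weight k (x : R) :=
  (b / 2) ^+ k / k`!%:R * (x `^ (p + k%:R) * expR (- b * x)).

Definition taylor_coef k (t : R) : R[i] :=
  cintegral mu Rp (fun x => (taylor_weight k x)%:C * cis ((t - x0) * x)).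

Lemma taylor_weightE k (x : R) : 0 <= x ->
  taylor_weight k x = x `^ p * expR (- b * x) * ((b / 2 * x) ^+ k / k`!%:R).
Proof.
move=> x_ge0; rewrite /taylor_weight powRD; last first.
  by rewrite gt_eqF// ltr_wpDr.
rewrite powR_mulrn// (exprMn _ (b / 2) x); ring.
Qed.

Lemma taylor_weight_ge0 k x : 0 <= taylor_weight k x.
Proof.
rewrite /taylor_weight mulr_ge0//; first by rewrite divr_ge0// exprn_ge0// divr_ge0// ltW.
by rewrite mulr_ge0 ?powR_ge0 ?expR_ge0.
Qed.

Lemma measurable_taylor_weight k : measurable_fun Rp (taylor_weight k).
Proof.
apply: measurable_funS (subsetT _) _ => //.
apply: measurable_funM => //; apply: measurable_funM; first exact: measurable_powR.
by apply: measurableT_comp => //; exact: mulrl_measurable.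
Qed.

Lemma measurable_cosM s : measurable_fun Rp (fun x => cos (s * x)).
Proof.
apply: measurable_funS (subsetT _) _ => //; apply: continuous_measurable_fun => x.
apply: (@continuous_comp _ _ _ (fun x => s * x) cos); last exact: continuous_cos.
by apply: cvgMr; exact: cvg_id.
Qed.

Lemma measurable_sinM s : measurable_fun Rp (fun x => sin (s * x)).
Proof.
apply: measurable_funS (subsetT _) _ => //; apply: continuous_measurable_fun => x.
apply: (@continuous_comp _ _ _ (fun x => s * x) sin); last exact: continuous_sin.
by apply: cvgMr; exact: cvg_id.
Qed.

Lemma cintegrable_expRN (c C s : R) (f : R -> R) : 0 < c -> measurable_fun Rp f ->
  (forall x : R, 0 <= x -> `|f x| <= C * expR (- c * x)) ->
  cintegrable mu Rp (fun x => (f x)%:C * cis (s * x)).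
Proof.
move=> c0 mf le; apply: (cintegrable_dom mRp (phi := fun x => C * expR (- c * x))).
- rewrite (_ : (fun x => _) = fun x => f x * cos (s * x)); last first.
    by apply/funext => x; rewrite ReM/= mul0r subr0.
  by apply: measurable_funM => //; exact: measurable_cosM.
- rewrite (_ : (fun x => _) = fun x => f x * sin (s * x)); last first.
    by apply/funext => x; rewrite ImM/= mul0r addr0.
  by apply: measurable_funM => //; exact: measurable_sinM.
- exact: (integrableZl mRp C (integrable_expRN c0)).
- move=> x /RpP x_ge0.
  by rewrite Normc.normcM cmod_cis mulr1 cmod_real le.
Qed.

Section bounds.
Variable C0 : R.
Hypothesis C0_gt0 : 0 < C0.
Hypothesis C0P : forall x : R, 0 <= x -> (1 + x) * x `^ p <= C0 * expR (b / 8 * x).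

(** (b x / 2)^k / k! is a term of the series of exp(b x / 2), so nothing depends on [k]. The rates -
    b, b / 8 and b / 2 add up to less than - b / 4. *)
Lemma taylor_weight_le k (x : R) : 0 <= x ->
  (1 + x) * taylor_weight k x <= C0 * expR (- (b / 4) * x).
Proof.
move=> x_ge0; rewrite taylor_weightE// !mulrA.
apply: (@le_trans _ _ (C0 * expR (b / 8 * x) * expR (- b * x) * expR (b / 2 * x))).
  have bx : 0 <= b / 2 * x by rewrite mulr_ge0// divr_ge0// ltW.
  rewrite -[X in X <= _]mulrA ler_pM//.
  - by rewrite !mulr_ge0 ?powR_ge0 ?expR_ge0// addr_ge0.
  - by rewrite divr_ge0// exprn_ge0.
  - by rewrite ler_wpM2r ?expR_ge0// C0P.
  - exact: expr_fact_le_expR.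
rewrite -!mulrA ler_wpM2l ?(ltW C0_gt0)// -!expRD ler_expR.
have : 0 <= b * x by rewrite mulr_ge0// ltW.
lra.
Qed.

Let taylor_weight_le1 k (x : R) : 0 <= x ->
  `|taylor_weight k x| <= C0 * expR (- (b / 4) * x).
Proof.
move=> x_ge0; rewrite ger0_norm ?taylor_weight_ge0//.
rewrite (le_trans _ (taylor_weight_le k x_ge0))//.
by rewrite ler_peMl ?taylor_weight_ge0// lerDl.
Qed.

Let b4 : 0 < b / 4. Proof. by rewrite divr_gt0. Qed.

Let I := \int[mu]_(x in Rp) expR (- (b / 4) * x).

Lemma taylor_coef_le k t : cmod (taylor_coef k t) <= 2 * (C0 * I).
Proof.
have iE := integrable_expRN b4.
rewrite /I -RintegralZl//; apply: cmod_cintegral_le => //.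
- exact: cintegrable_expRN b4 (measurable_taylor_weight k) (taylor_weight_le1 k).
- exact: integrableZl iE.
- move=> x /RpP x_ge0.
  by rewrite Normc.normcM cmod_cis mulr1 cmod_real taylor_weight_le1.
Qed.

(** The oscillation bound is homogeneous in the integrand. It is applied to the unnormalized [phi],
    with [C0 / c] as its upper bound, and multiplying back by [c] removes [k] from the right-hand
    side. *)
Lemma taylor_coef_decay k t :
  `|t - x0| * cmod (taylor_coef k t) <= 4 * (C0 + b * (C0 * I)).
Proof.
set s := t - x0.
have itw : mu.-integrable Rp (EFin \o taylor_weight k).
  exact: integrable_le_expRN b4 (measurable_taylor_weight k) (taylor_weight_le1 k).
pose c := (b / 2) ^+ k / k`!%:R.
have c0 : 0 < c by rewrite divr_gt0 ?exprn_gt0 ?divr_gt0// ltr0n fact_gt0.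
have H th : `|s| * `|\int[mu]_(x in Rp) (taylor_weight k x * cos (s * x + th))| <=
    2 * (C0 + b * (C0 * I)).
  pose phi (x : R) := x `^ (p + k%:R) * expR (- b * x).
  have iphi : mu.-integrable Rp (EFin \o phi).
    have := integrableZl mRp c^-1 itw; apply: eq_integrable => // x _ /=.
    by rewrite /taylor_weight -/c -/(phi x) -EFinM mulKf// gt_eqF.
  have pk : 0 < p + k%:R by rewrite ltr_wpDr.
  have := @Rintegral_cos_decay R (p + k%:R) b s th (C0 / c) phi pk b0 erefl iphi.
  have pB (x : R) : 0 <= x -> phi x <= C0 / c.
    move=> x_ge0; rewrite ler_pdivlMr// mulrC -/(taylor_weight k x).
    rewrite (le_trans (ler_norm _))// (le_trans (taylor_weight_le1 k x_ge0))//.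
    rewrite ler_piMr ?(ltW C0_gt0)// expR_le1 mulNr oppr_le0 mulr_ge0 ?(ltW b4)//.
  move=> /(_ pB) le.
  have -> : \int[mu]_(x in Rp) (taylor_weight k x * cos (s * x + th)) =
      c * \int[mu]_(x in Rp) (phi x * cos (s * x + th)).
    rewrite -RintegralZl//; first by apply: eq_Rintegral => x _; rewrite mulrA.
    apply: (le_integrable _ _ _ iphi) => //.
      apply/measurable_EFinP; apply: measurable_funM.
        by apply/measurable_EFinP; exact: measurable_int iphi.
      apply: measurable_funS (subsetT _) _ => //; apply: continuous_measurable_fun => x.
      apply: (@continuous_comp _ _ _ (fun x => s * x + th) cos); last exact: continuous_cos.
      by apply: cvgD; [apply: cvgMr; exact: cvg_id|exact: cvg_cst].
    move=> x _ /=; rewrite lee_fin normrM ler_piMr//.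
    by rewrite ler_norml cos_geN1 cos_le1.
  rewrite normrM (gtr0_norm c0) mulrCA; move: le.
  rewrite -(ler_pM2l c0) => /le_trans; apply.
  have -> : c * (2 * (C0 / c) + 2 * b * \int[mu]_(x in Rp) phi x) =
      2 * (C0 + b * \int[mu]_(x in Rp) taylor_weight k x).
    rewrite (_ : \int[mu]_(x in Rp) taylor_weight k x = c * \int[mu]_(x in Rp) phi x).
      by field; rewrite gt_eqF.
    by rewrite -RintegralZl//; apply: eq_Rintegral => x _.
  rewrite ler_wpM2l// lerD2l ler_wpM2l ?(ltW b0)//.
  exact: Rintegral_le_expRN b4 (measurable_taylor_weight k) (taylor_weight_le1 k).
apply: (le_trans (ler_wpM2l (normr_ge0 _) (cmod_le_ReIm _))).
rewrite mulrDr (_ : 4 = 2 + 2) ?[RHS]mulrDl; last by lra.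
rewrite mulrDl; apply: lerD.
  have := H 0; congr (_ * `| _ | <= _); apply: eq_Rintegral => x _.
  by rewrite ReM/= addr0 mul0r subr0.
(* The imaginary part is a cosine integral too: shifting the cosine by a quarter period gives the
   sine. *)
have := H (- (pi / 2)); congr (_ * `| _ | <= _); apply: eq_Rintegral => x _.
rewrite ImM/= mul0r addr0 cosD cosN sinN cos_pihalf sin_pihalf; ring.
Qed.

(** The phase contains the product of [t] and [x], so a Lipschitz bound in [t] costs a factor [x];
    the factor [1 + x] in [taylor_weight_le] pays for it. *)
Lemma taylor_coef_lip k s t :
  cmod (taylor_coef k t - taylor_coef k s) <= 4 * (C0 * I) * `|t - s|.
Proof.
have iE := integrable_expRN b4.
have ic u := cintegrable_expRN u b4 (measurable_taylor_weight k) (taylor_weight_le1 k).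
rewrite -[X in _ - X]mul1r -mulNr -cintegralZ// -cintegralD//; last exact: cintegrableZ.
have -> : 4 * (C0 * I) * `|t - s| = 2 * \int[mu]_(x in Rp) (2 * `|t - s| * C0 * expR (- (b / 4) *
  x)).
  by rewrite RintegralZl//; rewrite -/I; ring.
apply: cmod_cintegral_le => //.
- by apply: cintegrableD => //; exact: cintegrableZ.
- exact: (integrableZl mRp (2 * `|t - s| * C0) iE).
- move=> x /RpP x_ge0.
  rewrite mulNr mul1r -mulrBr Normc.normcM cmod_real.
  rewrite ger0_norm ?taylor_weight_ge0//.
  apply: (le_trans (ler_wpM2l (taylor_weight_ge0 k x) (cis_lip _ _))).
  have -> : (t - x0) * x - (s - x0) * x = (t - s) * x by ring.
  rewrite normrM (ger0_norm x_ge0).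
  have := taylor_weight_le k x_ge0.
  have : 0 <= taylor_weight k x := taylor_weight_ge0 k x.
  have : 0 <= `|t - s| by [].
  set w := taylor_weight k x; set v := `|t - s|; set e := expR _ => v0 w0 le.
  have : 0 <= v * (C0 * e - x * w) by rewrite mulr_ge0// subr_ge0; lra.
  nra.
Qed.

End bounds.
End wavelet_taylor.

Section wavelet_expansion.
Context {R : realType}.
Local Notation mu := (@lebesgue_measure R).
Local Notation Rp := (`[0%R, +oo[%classic : set (measurableTypeR R)).

Let mRp : measurable Rp. Proof. exact: measurable_itv. Qed.
Let RpP x : Rp x -> 0 <= x. Proof. by rewrite /= in_itv/= andbT. Qed.

Lemma measurable_powR_expRN (p y : R) : measurable_fun Rp (fun x => x `^ p * expR (- y * x)).
Proof.
apply: measurable_funS (subsetT _) _ => //.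
apply: measurable_funM; first exact: measurable_powR.
by apply: measurableT_comp => //; exact: mulrl_measurable.
Qed.

Lemma powR_expRN_le (p y : R) : 0 <= p -> 0 < y -> exists C : R, forall x : R, 0 <= x ->
  `|x `^ p * expR (- y * x)| <= C * expR (- (y / 2) * x).
Proof.
move=> p0 y0; have [C C0 CP] := powR_le_expR p0 (divr_gt0 y0 (@ltr0n R 2)).
exists C => x x0; rewrite ger0_norm ?mulr_ge0 ?powR_ge0 ?expR_ge0//.
apply: (@le_trans _ _ (C * expR (y / 2 * x) * expR (- y * x))).
  rewrite ler_wpM2r ?expR_ge0// (le_trans _ (CP x x0))//.
  by rewrite ler_peMl ?powR_ge0// lerDl.
rewrite -mulrA -expRD ler_wpM2l ?(ltW C0)// ler_expR; lra.
Qed.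

Lemma cintegrable_powR_expRN (p y s : R) : 0 <= p -> 0 < y ->
  cintegrable mu Rp (fun x => (x `^ p * expR (- y * x))%:C * cis (s * x)).
Proof.
move=> p0 y0; have [C CP] := powR_expRN_le p0 y0.
apply: cintegrable_expRN CP; first by rewrite divr_gt0.
exact: measurable_powR_expRN.
Qed.

Lemma cintegral_scale (y : R) (f : R -> R[i]) : 0 < y -> cintegrable mu Rp f ->
  cintegral mu Rp f = y%:C * cintegral mu Rp (fun x => f (y * x)).
Proof.
move=> y0 [f1 f2]; apply: complexP.
  by rewrite ReM/= mul0r subr0; exact: Rintegral_scale y0 f1.
by rewrite ImM/= mul0r addr0; exact: Rintegral_scale y0 f2.
Qed.

(** Rescaling the frequency by [z.2] removes the division by [z.2] from the phase. Under the
    integral, besides x^p, there remains exp(i x (t - conj z)) with z = z.1 + i z.2, which is a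
    power series in conj z; the prefactor depends on [z.2] alone and stays outside. *)
Lemma wavelet_atomE (alpha : R) (z : R * R) t : 1 < alpha -> 0 < z.2 ->
  let p := (alpha - 1) / 2 in
  wavelet_atom alpha z t = (z.2 `^ (- 2^-1) * (z.2 * z.2 `^ p))%:C *
    cintegral mu Rp (fun x => (x `^ p * expR (- z.2 * x))%:C * cis ((t - z.1) * x)).
Proof.
case: z => x y /= a1 y0; set p := _ / 2; have p0 : 0 < p by rewrite divr_gt0// subr_gt0.
rewrite /wavelet_atom /translate /dilate /= !rmorphM/= -!mulrA; congr (_ * _).
rewrite /cauchy_wavelet; set s := (t - x) / y.
have -> : cintegral mu Rp (fun xi => (cauchy_wavelet_hat alpha xi)%:C *
      (cos (s * xi) +i* sin (s * xi))) =
    cintegral mu Rp (fun u => (u `^ p * expR (- 1 * u))%:C * cis (s * u)).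
  by apply: eq_cintegral => u /RpP u0; rewrite /cauchy_wavelet_hat u0 mulN1r.
rewrite (cintegral_scale y0); last exact: (cintegrable_powR_expRN _ (ltW p0)).
congr (_ * _); rewrite -cintegralZ//; last exact: (cintegrable_powR_expRN _ (ltW p0)).
apply: eq_cintegral => u /RpP u0.
rewrite powRM ?(ltW y0)// mulN1r mulNr !rmorphM/= -!mulrA.
by congr (_ * (_ * (_ * cis _))); rewrite mulKf// gt_eqF.
Qed.

(** Here h = - i conj(z - z0): the integrand at z is the integrand at z0 times [cexp (u%:C * h)],
    and the k-th term of this exponential yields q^k times the k-th weight. The radius b / 16 gives
    |h| <= b / 8, so that exp(u |h|) costs at most exp(b u / 8). *)
Lemma wavelet_taylor_remainder (p b y x0 x t C0 : R) K : 0 < p -> 0 < b ->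
  0 < C0 -> (forall x : R, 0 <= x -> (1 + x) * x `^ p <= C0 * expR (b / 8 * x)) ->
  `|x - x0| <= b / 16 -> `|y - b| <= b / 16 ->
  let q := (2 / b)%:C * ((b - y) +i* (x0 - x)) in
  cmod q <= 1 / 2 /\
  cmod (cintegral mu Rp (fun u => (u `^ p * expR (- y * u))%:C * cis ((t - x) * u)) -
    \sum_(k < K) q ^+ k * taylor_coef p b x0 k t) <=
  4 * (C0 * \int[mu]_(x in Rp) expR (- (b / 4) * x)) * (1 / 2) ^+ K.
Proof.
move=> p0 b0 C00 C0P xx0 yb; set h := _ +i* _ => q.
have y0 : 0 < y by move: yb; rewrite ler_norml; lra.
have b40 : 0 < b / 4 by rewrite divr_gt0.
have hb : cmod h <= b / 8.
  rewrite (le_trans (cmod_le_ReIm _))//= distrC (distrC x0); lra.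
have qh : cmod q = 2 / b * cmod h.
  by rewrite Normc.normcM cmod_real ger0_norm// divr_ge0// ltW.
have q2 : cmod q <= 1 / 2.
  by rewrite qh mulrAC ler_pdivrMr//; lra.
split => //.
have itc k : cintegrable mu Rp (fun u => (taylor_weight p b k u)%:C * cis ((t - x0) * u)).
  apply: (@cintegrable_expRN _ (b / 4) C0) => //; first exact: measurable_taylor_weight.
  move=> u u0; rewrite ger0_norm ?taylor_weight_ge0//.
  rewrite (le_trans _ (taylor_weight_le p0 b0 C00 C0P k u0))//.
  by rewrite ler_peMl ?taylor_weight_ge0// lerDl.
have ii := cintegrable_powR_expRN (t - x) (ltW p0) y0.
have iq k := cintegrableZ mRp (q ^+ k) (itc k).
under eq_bigr => k _ do rewrite -(cintegralZ mRp _ (itc k)).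
have [isum sumE] := cintegral_sum mRp K iq.
rewrite -sumE -[X in _ - X]mul1r -mulNr -cintegralZ// -cintegralD//; last exact: cintegrableZ.
have -> : 4 * (C0 * \int[mu]_(x in Rp) expR (- (b / 4) * x)) * (1 / 2) ^+ K =
  2 * \int[mu]_(x in Rp) (2 * C0 * (1 / 2) ^+ K * expR (- (b / 4) * x)).
  by rewrite RintegralZl//; [ring|exact: integrable_expRN].
apply: cmod_cintegral_le => //.
- by apply: cintegrableD => //; exact: cintegrableZ.
- exact: (integrableZl mRp _ (integrable_expRN b40)).
move=> u /RpP u0.
have uE : (u `^ p * expR (- y * u))%:C * cis ((t - x) * u) =
    (u `^ p * expR (- b * u))%:C * cis ((t - x0) * u) * cexp (u%:C * h).
  rewrite /cexp ReM ImM/= !mul0r subr0 addr0.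
  have -> : - y * u = - b * u + u * (b - y) by ring.
  have -> : (t - x) * u = (t - x0) * u + u * (x0 - x) by ring.
  rewrite expRD cisD !rmorphM/=; ring.
have qE k : q ^+ k * ((taylor_weight p b k u)%:C * cis ((t - x0) * u)) =
    (u `^ p * expR (- b * u))%:C * cis ((t - x0) * u) * ((u%:C * h) ^+ k * (k`!%:R^-1)%:C).
  have qu : q * (b / 2 * u)%:C = u%:C * h.
    rewrite /q mulrAC -mulrA mulrA.
    apply: complexP; rewrite !(ReM, ImM)/= !(mul0r, mulr0, subr0, addr0); field; by rewrite gt_eqF.
  have G (A B C : R) (Q c : R[i]) :
      Q * ((A * (B * C))%:C * c) = A%:C * c * (Q * B%:C * C%:C).
    by rewrite !rmorphM/=; ring.
  by rewrite taylor_weightE// -qu (exprMn _ q) -rmorphXn; exact: G.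
rewrite uE; under eq_bigr do rewrite qE.
rewrite -mulr_sumr mulN1r -mulrBr Normc.normcM Normc.normcM cmod_cis mulr1 cmod_real.
rewrite ger0_norm ?mulr_ge0 ?powR_ge0 ?expR_ge0//.
have := cexp_taylor (u%:C * h) K.
rewrite Normc.normcM cmod_real (ger0_norm u0) => le.
apply: (le_trans (ler_wpM2l _ le)); first by rewrite mulr_ge0 ?powR_ge0 ?expR_ge0.
have -> : u * cmod h = cmod q * (b / 2 * u).
  by rewrite qh; field; rewrite gt_eqF.
have bu : 0 <= b / 2 * u by rewrite mulr_ge0// divr_ge0// ltW.
have h1 : (cmod q * (b / 2 * u)) ^+ K / K`!%:R <= (1 / 2) ^+ K * expR (b / 2 * u).
  rewrite (exprMn _ (cmod q)) -(mulrA (cmod q ^+ K)); apply: ler_pM; last exact: expr_fact_le_expR.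
  - by rewrite exprn_ge0// cmod_ge0.
  - by rewrite divr_ge0// exprn_ge0.
  - by rewrite lerXn2r ?nnegrE ?cmod_ge0.
have h2 : u `^ p <= C0 * expR (b / 8 * u).
  by rewrite (le_trans _ (C0P u u0))// ler_peMl ?powR_ge0// lerDl.
have h3 : expR (cmod q * (b / 2 * u)) <= expR (b / 8 * u).
  rewrite ler_expR qh (_ : _ * _ = cmod h * u) ?ler_wpM2r//.
  by field; rewrite gt_eqF.
apply: (@le_trans _ _ (C0 * expR (b / 8 * u) * expR (- b * u) *
   (2 * ((1 / 2) ^+ K * expR (b / 2 * u) * expR (b / 8 * u))))).
  apply: ler_pM.
  - by rewrite mulr_ge0 ?powR_ge0 ?expR_ge0.
  - by rewrite mulr_ge0// mulr_ge0 ?expR_ge0// divr_ge0// exprn_ge0// mulr_ge0// cmod_ge0.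
  - by rewrite ler_wpM2r ?expR_ge0.
  - by rewrite ler_wpM2l// ler_pM ?expR_ge0// divr_ge0// exprn_ge0// mulr_ge0// cmod_ge0.
(* The rates add up exactly: b / 8 from [C0P], - b from the integrand, b / 2 from the Taylor term of
   order [K], b / 8 from exp(u |h|). *)
rewrite (_ : - (b / 4) * u = b / 8 * u + (- b * u + (b / 2 * u + b / 8 * u))); last by field.
rewrite !expRD le_eqVlt; apply/orP; left; apply/eqP; ring.
Qed.

End wavelet_expansion.

Section wavelet_atom_expansion.
Context {R : realType}.
Local Notation mu := (@lebesgue_measure R).
Local Notation Rp := (`[0%R, +oo[%classic : set (measurableTypeR R)).

(** Discards an error that is geometric in a truncation order; its constant may depend on everything
    else. *)
Lemma ler_half_exp (x y c : R) : (forall n, x <= y + c * (1 / 2) ^+ n) -> x <= y.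
Proof.
move=> H; have cv : y + c * (1 / 2) ^+ n @[n --> \oo] --> y + c * 0.
  apply: cvgD; first exact: cvg_cst.
  apply: cvgMr; apply: cvg_expr.
  by rewrite ger0_norm//; lra.
rewrite -[y]addr0 -(mulr0 c); apply: (cvgr_to_ge cv); exact: nearW.
Qed.

Lemma sum_half_exp K m : \sum_(k < m) (1 / 2 : R) ^+ (K + k) <= 2 * (1 / 2) ^+ K.
Proof.
suff -> : \sum_(k < m) (1 / 2 : R) ^+ (K + k) = 2 * (1 / 2) ^+ K * (1 - (1 / 2) ^+ m).
  by rewrite ler_piMr ?mulr_ge0 ?exprn_ge0// lerBlDr lerDl exprn_ge0.
elim: m => [|m IH]; first by rewrite big_ord0 expr0 subrr mulr0.
by rewrite big_ord_recr/= IH exprS exprD; field.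
Qed.

(** The first factor decreases in [y] and the second increases, so the constant takes each at its
    worst endpoint. The range contains all heights within b / 16 of b. *)
Lemma powR_atom_bound (p b : R) : 0 < p -> 0 < b ->
  exists2 C : R, 0 < C & forall y, b / 2 <= y <= 2 * b ->
    y `^ (- 2^-1) * (y * y `^ p) <= C.
Proof.
move=> p0 b0; exists ((b / 2) `^ (- 2^-1) * (2 * b * (2 * b) `^ p)).
  by rewrite !mulr_gt0 ?powR_gt0 ?mulr_gt0// divr_gt0.
move=> y /andP[by1 by2]; have b2 : 0 < b / 2 by rewrite divr_gt0.
have y0 : 0 < y by exact: lt_le_trans by1.
apply: ler_pM.
- exact: powR_ge0.
- by rewrite mulr_ge0 ?powR_ge0// ltW.
- rewrite !powRN lef_pV2 ?posrE ?powR_gt0//.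
  by rewrite ge0_ler_powR ?nnegrE ?(ltW b2) ?(ltW y0)// invr_ge0.
- apply: ler_pM; rewrite ?powR_ge0 ?(ltW y0)//.
  by rewrite ge0_ler_powR ?nnegrE ?(ltW p0) ?(ltW y0)// mulr_ge0// ltW.
Qed.

(** The last bound carries the weight 1 + |t| because [noise_sum_le] controls the noise of a
    function only through this weight. A single [C] dominates all the bounds. *)
Lemma wavelet_atom_expansion (alpha : R) (z0 : R * R) : 1 < alpha -> 0 < z0.2 ->
  exists C : R, exists g : nat -> R -> R[i],
  [/\ 0 < C,
      forall k t, cmod (g k t) * (1 + `|t|) <= C,
      forall k s t, cmod (g k t - g k s) <= C * `|t - s| &
      forall z : R * R, `|z.1 - z0.1| <= z0.2 / 16 -> `|z.2 - z0.2| <= z0.2 / 16 ->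
      exists c : R, exists q : R[i],
      [/\ 0 <= c <= C, cmod q <= 1 / 2 &
          forall K t, cmod (wavelet_atom alpha z t - c%:C * \sum_(k < K) q ^+ k * g k t) *
            (1 + `|t|) <= C * (1 / 2) ^+ K]].
Proof.
case: z0 => x0 b /= a1 b0; pose p := (alpha - 1) / 2.
have p0 : 0 < p by rewrite divr_gt0// subr_gt0.
have b8 : 0 < b / 8 by rewrite divr_gt0.
have [C0 C00 C0P] := powR_le_expR (ltW p0) b8.
have [cm cm0 cmP] := powR_atom_bound p0 b0.
pose I := \int[mu]_(x in Rp) expR (- (b / 4) * x).
have I0 : 0 <= I by apply: Rintegral_ge0 => x _; exact: expR_ge0.
have CI0 : 0 <= C0 * I by rewrite mulr_ge0// ltW.
pose g := taylor_coef p b x0.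
pose A := (1 + `|x0|) * (2 * (C0 * I)) + 4 * (C0 + b * (C0 * I)).
have A0 : 0 <= A.
  by rewrite addr_ge0// mulr_ge0// ?addr_ge0 ?mulr_ge0// ltW.
have gA k t : cmod (g k t) * (1 + `|t|) <= A.
  apply: (@le_trans _ _ (cmod (g k t) * (1 + `|x0| + `|t - x0|))).
    rewrite ler_wpM2l ?cmod_ge0// -addrA lerD2l.
    by rewrite -{1}(subrK x0 t) addrC (le_trans (ler_normD _ _))// addrC.
  rewrite mulrDr mulrC (mulrC _ `|_|); apply: lerD.
    by rewrite ler_wpM2l ?addr_ge0// taylor_coef_le.
  exact: taylor_coef_decay.
have cmA : 0 <= cm * (2 * A) by rewrite !mulr_ge0// ltW.
exists (A + 4 * (C0 * I) + cm + cm * (2 * A)), g; split.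
- have : 0 <= 4 * (C0 * I) by rewrite mulr_ge0.
  lra.
- by move=> k t; rewrite (le_trans (gA k t))//; lra.
- move=> k s t; rewrite (le_trans (taylor_coef_lip x0 p0 b0 C00 C0P k s t))//.
  by rewrite ler_wpM2r// -/I; lra.
move=> [x y] /= hx hy.
have y0 : 0 < y by move: hy; rewrite ler_norml; lra.
pose c := y `^ (- 2^-1) * (y * y `^ p).
have c0 : 0 <= c by rewrite /c !mulr_ge0 ?powR_ge0// ltW.
have ccm : c <= cm by apply: cmP; move: hy; rewrite ler_norml; lra.
pose q := (2 / b)%:C * ((b - y) +i* (x0 - x)).
have rem t K := wavelet_taylor_remainder t K p0 b0 C00 C0P hx hy.
have [q2 _] := rem 0 0%N.
exists c, q; split => //; first by rewrite c0/=; lra.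
move=> K t; rewrite wavelet_atomE//= -/p -/c.
set Ps := cintegral _ _ _; rewrite -mulrBr Normc.normcM cmod_real (ger0_norm c0).
have {}rem L : cmod (Ps - \sum_(k < L) q ^+ k * g k t) <= 4 * (C0 * I) * (1 / 2) ^+ L.
  by have [_] := rem t L.
(* [wavelet_taylor_remainder] has no weight. The remainder of order K is therefore split into the
   terms K, ..., K + m - 1, which decay by [gA], and the remainder of order K + m, whose product
   with 1 + |t| vanishes as m grows, t being fixed. *)
have main : cmod (Ps - \sum_(k < K) q ^+ k * g k t) * (1 + `|t|) <= 2 * A * (1 / 2) ^+ K.
  have t0 : 0 <= 1 + `|t| by rewrite addr_ge0.
  apply: (@ler_half_exp _ _ (4 * (C0 * I) * (1 + `|t|))) => m.
  have -> : Ps - \sum_(k < K) q ^+ k * g k t = (Ps - \sum_(k < K + m) q ^+ k * g k t) +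
      \sum_(k < m) q ^+ (K + k) * g (K + k)%N t.
    by rewrite big_split_ord/=; ring.
  apply: (le_trans (ler_wpM2r t0 (cmodD _ _))); rewrite mulrDl addrC; apply: lerD.
    apply: (le_trans (ler_wpM2r t0 (cmod_sum m (fun k => q ^+ (K + k) * g (K + k)%N t)))).
    rewrite mulr_suml; apply: (@le_trans _ _ (\sum_(k < m) A * (1 / 2) ^+ (K + k))).
      apply: ler_sum => k _; rewrite Normc.normcM cmod_exp -mulrA mulrC.
      apply: ler_pM => //; rewrite ?exprn_ge0 ?cmod_ge0 ?mulr_ge0 ?cmod_ge0//.
      by rewrite lerXn2r ?nnegrE ?cmod_ge0.
    by rewrite -mulr_sumr -(mulrA 2) mulrCA ler_wpM2l// sum_half_exp.
  rewrite mulrAC ler_wpM2r// (le_trans (rem _))// ler_wpM2l//; first by rewrite mulr_ge0.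
  by rewrite exprD ler_piMl ?exprn_ge0// exprn_ile1//; lra.
rewrite -mulrA; apply: (le_trans (ler_wpM2l c0 main)).
rewrite (mulrA c) ler_wpM2r ?exprn_ge0//.
have : c * (2 * A) <= cm * (2 * A) by rewrite ler_wpM2r// mulr_ge0.
have : 0 <= 4 * (C0 * I) by rewrite mulr_ge0.
lra.
Qed.
End wavelet_atom_expansion.

(** * Gaussian moments *)

Section cmeasurable_theory.
Context {d} {T : measurableType d} {R : realType}.
Implicit Types f g : T -> R[i].

Lemma cmeasurableP f : cmeasurable f <->
  measurable_fun setT (fun x => complex.Re (f x)) /\
  measurable_fun setT (fun x => complex.Im (f x)).
Proof. exact: measurable_fun_pairP. Qed.

Lemma cmeasurable_cst (c : R[i]) : cmeasurable (fun _ : T => c).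
Proof. by apply/cmeasurableP. Qed.

Lemma cmeasurable_real (h : T -> R) : measurable_fun setT h ->
  cmeasurable (fun x => (h x)%:C).
Proof. by move=> mh; apply/cmeasurableP; split. Qed.

Lemma cmeasurableD f g : cmeasurable f -> cmeasurable g ->
  cmeasurable (fun x => f x + g x).
Proof.
move=> /cmeasurableP[f1 f2] /cmeasurableP[g1 g2]; apply/cmeasurableP; split.
  by rewrite (_ : (fun x => _) = fun x => complex.Re (f x) + complex.Re (g x));
    [exact: measurable_funD|apply/funext => x; rewrite ReD].
by rewrite (_ : (fun x => _) = fun x => complex.Im (f x) + complex.Im (g x));
  [exact: measurable_funD|apply/funext => x; rewrite ImD].
Qed.

Lemma cmeasurableM f g : cmeasurable f -> cmeasurable g ->
  cmeasurable (fun x => f x * g x).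
Proof.
move=> /cmeasurableP[f1 f2] /cmeasurableP[g1 g2]; apply/cmeasurableP; split.
  rewrite (_ : (fun x => _) = fun x => complex.Re (f x) * complex.Re (g x) -
      complex.Im (f x) * complex.Im (g x)); last by apply/funext => x; rewrite ReM.
  by apply: measurable_funB; exact: measurable_funM.
rewrite (_ : (fun x => _) = fun x => complex.Re (f x) * complex.Im (g x) +
    complex.Im (f x) * complex.Re (g x)); last by apply/funext => x; rewrite ImM.
by apply: measurable_funD; exact: measurable_funM.
Qed.

Lemma cmeasurableN f : cmeasurable f -> cmeasurable (fun x => - f x).
Proof.
move=> mf; rewrite (_ : (fun x => _) = fun x => (- 1) * f x).
  by apply: cmeasurableM => //; exact: cmeasurable_cst.
by apply/funext => x; rewrite mulN1r.
Qed.

Lemma cmeasurableB f g : cmeasurable f -> cmeasurable g ->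
  cmeasurable (fun x => f x - g x).
Proof. by move=> mf mg; apply: cmeasurableD => //; exact: cmeasurableN. Qed.

Lemma cmeasurable_sum n (F : nat -> T -> R[i]) : (forall k, cmeasurable (F k)) ->
  cmeasurable (fun x => \sum_(k < n) F k x).
Proof.
move=> mF; elim: n => [|n IH].
  rewrite (_ : (fun x => _) = fun=> 0); first exact: cmeasurable_cst.
  by apply/funext => x; rewrite big_ord0.
rewrite (_ : (fun x => _) = fun x => \sum_(k < n) F k x + F n x).
  exact: cmeasurableD.
by apply/funext => x; rewrite big_ord_recr.
Qed.

Lemma cmeasurable_conj f : cmeasurable f -> cmeasurable (fun x => conjc (f x)).
Proof.
move=> /cmeasurableP[f1 f2]; apply/cmeasurableP; split.
  by rewrite (_ : (fun x => _) = fun x => complex.Re (f x))//; apply/funext => x; case: (f x).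
by rewrite (_ : (fun x => _) = fun x => - complex.Im (f x));
  [exact: measurable_funN|apply/funext => x; case: (f x)].
Qed.

Lemma measurable_cmodX f q : cmeasurable f ->
  measurable_fun setT (fun x => cmod (f x) ^+ q).
Proof.
move=> /cmeasurableP[f1 f2]; apply: measurable_funX.
rewrite (_ : (fun x => _) = fun x => Num.sqrt (complex.Re (f x) ^+ 2 + complex.Im (f x) ^+ 2)).
  apply: measurableT_comp; first exact: continuous_measurable_fun (@sqrt_continuous R).
  by apply: measurable_funD; exact: measurable_funX.
by apply/funext => x; rewrite cmodE.
Qed.

End cmeasurable_theory.

(** * Integration against a law *)

Section change_of_variables.
Local Open Scope ereal_scope.
Import HBNNSimple.
Context {d1 d2} {T1 : measurableType d1} {T2 : measurableType d2} {R : realType}.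
Variables (m : {measure set T1 -> \bar R}) (nu : {measure set T2 -> \bar R}).
Variables (B : set T1) (G : T1 -> R) (X : T1 -> T2) (K : R).
Hypotheses (mB : measurable B) (mG : measurable_fun B G) (G0 : forall x, B x -> (0 <= G x)%R).
Hypotheses (mX : measurable_fun setT X).
Hypothesis lawX : forall A, measurable A ->
  \int[m]_(x in B `&` X @^-1` A) (G x)%:E = K%:E * nu A.

Let integral_nnsfun_law (h : {nnsfun T2 >-> R}) :
  \int[m]_(x in B) ((G x)%:E * (h (X x))%:E) = K%:E * \int[nu]_x (h x)%:E.
Proof.
have mA r : measurable (h @^-1` [set r]) by [].
have mXA r : measurable (X @^-1` (h @^-1` [set r])).
  by rewrite -[X in measurable X]setTI; exact: mX.
have mGB r : measurable_fun B (fun x => (G x)%:E * (\1_(h @^-1` [set r]) (X x))%:E).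
  apply: emeasurable_funM; first exact/measurable_EFinP; apply/measurable_EFinP.
  apply: measurable_funS (subsetT _) _ => //.
  apply: measurableT_comp => //; exact: measurable_indic.
transitivity (\int[m]_(x in B) (\sum_(r \in range h)
    (r%:E * ((G x)%:E * (\1_(h @^-1` [set r]) (X x))%:E)))).
  apply: eq_integral => x /set_mem Bx.
  rewrite (fimfunE h) -fsumEFin// ge0_mule_fsumr//.
    by apply: eq_fsbigr => r _; rewrite EFinM muleCA.
  by move=> r; rewrite EFinM nnfun_muleindic_ge0.
rewrite ge0_integral_fsum//; last 2 first.
- by move=> r; exact: measurable_funeM.
- move=> r x Bx; rewrite muleCA; apply: mule_ge0; first by rewrite lee_fin G0.
  exact: nnfun_muleindic_ge0.
transitivity (\sum_(r \in range h) (K%:E * (r%:E * nu (h @^-1` [set r])))).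
  apply: eq_fsbigr => r /set_mem[y _ <-].
  rewrite ge0_integralZl//; last 2 first.
  - by move=> x Bx; rewrite mule_ge0 ?lee_fin ?G0// lee_fin.
  - by rewrite lee_fin.
  rewrite muleCA -lawX//; congr (_ * _).
  rewrite integral_mkcondr epatch_indic; apply: eq_integral => x _ /=.
  by [].
rewrite -ge0_mule_fsumr//; last first.
  by move=> r; exact: nnsfun_mulemu_ge0.
by congr (_ * _); rewrite integralT_nnsfun sintegralE.
Qed.

(** Serves two purposes. With [X] the identity and [G] the normal density, it integrates against a
    normal law; with [B] a cylinder, [G] a product of functions of the earlier variables and [X] the
    next variable, [lawX] expresses independence. *)
Lemma ge0_integral_law (f : T2 -> \bar R) : measurable_fun setT f ->
  (forall x, 0 <= f x) ->
  \int[m]_(x in B) ((G x)%:E * f (X x)) = K%:E * \int[nu]_x f x.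
Proof.
move=> mf f0.
pose h := nnsfun_approx measurableT mf.
have hf x : (h n x)%:E @[n --> \oo] --> f x by apply: cvg_nnsfun_approx.
have hnd x : {homo (fun n => (h n x)%:E) : n n' / (n <= n')%N >-> n <= n'}.
  by move=> n n' nn'; rewrite lee_fin; exact/lefP/nd_nnsfun_approx.
have mh n : measurable_fun B (fun x => (G x)%:E * (h n (X x))%:E).
  apply: emeasurable_funM; first exact/measurable_EFinP; apply/measurable_EFinP.
  by apply: measurable_funS (subsetT _) _ => //; exact: measurableT_comp.
have c1 : \int[m]_(x in B) ((G x)%:E * (h n (X x))%:E) @[n --> \oo] -->
    \int[m]_(x in B) ((G x)%:E * f (X x)).
  rewrite (_ : \int[m]_(x in B) ((G x)%:E * f (X x)) =
      \int[m]_(x in B) (fun x => limn (fun n => (G x)%:E * (h n (X x))%:E)) x).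
    apply: cvg_monotone_convergence => //.
    - by move=> n x Bx; rewrite mule_ge0 ?lee_fin ?G0// lee_fin.
    - by move=> x Bx n n' nn'; apply: lee_wpmul2l; [rewrite lee_fin; exact: G0|exact: hnd].
  apply: eq_integral => x /set_mem Bx; apply/esym/cvg_lim => //.
  exact: cvgeZl.
have c2 : \int[nu]_x (h n x)%:E @[n --> \oo] --> \int[nu]_x f x.
  rewrite (_ : \int[nu]_x f x = \int[nu]_x (fun x => limn (fun n => (h n x)%:E)) x).
    apply: cvg_monotone_convergence => //.
    - by move=> n; apply/measurable_EFinP.
    - by move=> n x _; rewrite lee_fin.
  by apply: eq_integral => x _; apply/esym/cvg_lim => //.
move: c1; under eq_fun do rewrite integral_nnsfun_law.
move=> c1; apply: (cvg_unique _ c1) => //.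
exact: (cvgeZl _ c2).
Qed.
End change_of_variables.

Section gaussian_mgf.
Context {R : realType}.
Local Notation gauss := (normal_prob (0 : R) (Num.sqrt 2^-1) \x normal_prob 0 (Num.sqrt 2^-1))%E.

(** Completing the square turns the integrand into a constant times the normal density centred at
    [t * s ^+ 2], whose integral is 1. *)
Lemma normal_prob_mgf (s t : R) : s != 0 ->
  (\int[normal_prob 0 s]_x (expR (t * x))%:E)%E = (expR (t ^+ 2 * s ^+ 2 / 2))%:E.
Proof.
move=> s0.
have mE : measurable_fun [set: measurableTypeR R] (fun x : R => (expR (t * x))%:E).
  apply/measurable_EFinP; apply: measurableT_comp => //; exact: mulrl_measurable.
have := @ge0_integral_law _ _ (measurableTypeR R) (measurableTypeR R) R
  lebesgue_measure (normal_prob 0 s) setT (normal_pdf 0 s) id 1 measurableT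
  (measurable_normal_pdf 0 s) (fun x _ => normal_pdf_ge0 0 s x)
  (@measurable_id _ _ _) _ (fun x => (expR (t * x))%:E) mE _.
rewrite mul1e => <-; last 2 first.
- by move=> A mA; rewrite mul1e setTI preimage_id.
- by move=> x; rewrite lee_fin expR_ge0.
transitivity (\int[lebesgue_measure]_x
    ((expR (t ^+ 2 * s ^+ 2 / 2))%:E * (normal_pdf (t * s ^+ 2) s x)%:E))%E.
  apply: eq_integral => x _; rewrite -!EFinM !normal_pdfE// /normal_fun.
  rewrite [in RHS]mulrCA -[in LHS](mulrA (normal_peak s)) -!expRD; congr (_ * expR _)%:E.
  by field.
rewrite ge0_integralZl//.
- by rewrite integral_normal_pdf mule1.
- by apply/measurable_EFinP; exact: measurable_normal_pdf.
- by move=> x _; rewrite lee_fin normal_pdf_ge0.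
Qed.

(** The exponent is the real part of [c] times z.1 + i z.2. Each of the two parts has variance 1/2,
    hence |c|^2 / 4 on the right. *)
Lemma gauss_mgf (c : R[i]) :
  (\int[gauss]_z (expR (complex.Re c * z.1 - complex.Im c * z.2))%:E)%E =
  (expR (cmod c ^+ 2 / 4))%:E.
Proof.
set a := complex.Re c; set b := complex.Im c.
have s0 : Num.sqrt (2^-1 : R) != 0 by rewrite gt_eqF// sqrtr_gt0 invr_gt0.
have m1 (u : R) : measurable_fun [set: measurableTypeR R] (fun x : R => (expR (u * x))%:E).
  apply/measurable_EFinP; apply: measurableT_comp => //; exact: mulrl_measurable.
have mf : measurable_fun setT (fun z : measurableTypeR R * measurableTypeR R => (expR (a * z.1 -
  b * z.2))%:E).
  apply/measurable_EFinP; apply: measurableT_comp => //; apply: measurable_funB.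
    by apply: measurableT_comp => //; exact: mulrl_measurable.
  by apply: measurableT_comp => //; exact: mulrl_measurable.
rewrite fubini_tonelli1//.
rewrite /fubini_F/=.
transitivity (\int[normal_prob 0 (Num.sqrt 2^-1)]_x
   ((expR (b ^+ 2 * 2^-1 / 2))%:E * (expR (a * x))%:E))%E.
  apply: eq_integral => x _.
  under eq_integral => y _ do rewrite expRD EFinM -mulNr.
  rewrite ge0_integralZl//.
  by rewrite normal_prob_mgf// sqrrN sqr_sqrtr ?invr_ge0// muleC.
rewrite ge0_integralZl//.
rewrite normal_prob_mgf// sqr_sqrtr ?invr_ge0// -EFinM -expRD cmod_sqr.
by congr (expR _)%:E; rewrite -/a -/b; field.
Qed.
End gaussian_mgf.

Section independent_gaussians.
Context {d} {Om : measurableType d} {R : realType} (P : probability Om R).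
Variable a : nat -> Om -> R[i].
Hypothesis ha : forall n, standard_complex_gaussian P (a n).
Hypothesis hind : mutually_independent P a.
Local Notation gauss := (normal_prob (0 : R) (Num.sqrt 2^-1) \x normal_prob 0 (Num.sqrt 2^-1))%E.

Let mX k : measurable_fun setT (C2R2 \o a k). Proof. by have [] := ha k. Qed.

Let cyl (J : {fset nat}) (A : nat -> set (R * R)) :=
  \bigcap_(j in [set` J]) (a j @^-1` (C2R2 @^-1` A j)).

Let mpre k (A : set (R * R)) : measurable A -> measurable (a k @^-1` (C2R2 @^-1` A)).
Proof. by move=> mA; rewrite -[X in measurable X]setTI; exact: mX. Qed.

Let mcyl J A : (forall j, measurable (A j)) -> measurable (cyl J A).
Proof.
move=> mA; rewrite /cyl bigcap_fset; apply: bigsetI_measurable => j _; exact: mpre.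
Qed.

(* The hypothesis of independence is about events only; integrating over a cylinder
   in the later variables makes the induction on [m] reduce to it. *)
Lemma integral_indep_prod (f : nat -> R * R -> R) (c : nat -> R) :
  (forall k, measurable_fun setT (f k)) -> (forall k z, 0 <= f k z) ->
  (forall k, (\int[gauss]_z (f k z)%:E)%E = (c k)%:E) ->
  forall m (J : {fset nat}) (A : nat -> set (R * R)),
  (forall j, measurable (A j)) -> (forall j, j \in J -> (m <= j)%N) ->
  (\int[P]_(w in cyl J A) (\prod_(k < m) f k (C2R2 (a k w)))%:E =
   (\prod_(k < m) c k)%:E * P (cyl J A))%E.
Proof.
move=> mf f0 fc; elim => [|m IH] J A mA Jm.
  under eq_integral do rewrite big_ord0.
  by rewrite big_ord0 integral_cst//; exact: mcyl.
have mprod n : measurable_fun setT (fun w => \prod_(k < n) f k (C2R2 (a k w))).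
  elim: n => [|n IHn].
    by rewrite (_ : (fun w => _) = cst 1)//; apply/funext => w; rewrite big_ord0.
  rewrite (_ : (fun w => _) = fun w => \prod_(k < n) f k (C2R2 (a k w)) * f n (C2R2 (a n w)));
    last first.
    by apply/funext => w; rewrite big_ord_recr.
  by apply: measurable_funM => //; exact: (measurableT_comp (mf n) (mX n)).
have fin J' A' : (forall j, measurable (A' j)) -> P (cyl J' A') \is a fin_num.
  by move=> mA'; apply: fin_num_measure; exact: mcyl.
have mG : measurable_fun (cyl J A) (fun w => \prod_(k < m) f k (C2R2 (a k w))).
  exact: measurable_funS (mprod m).
have G0 w : cyl J A w -> 0 <= \prod_(k < m) f k (C2R2 (a k w)).
  by move=> _; apply: prodr_ge0.
have H := @ge0_integral_law _ _ Om _ R P gauss (cyl J A)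
  (fun w => \prod_(k < m) f k (C2R2 (a k w))) (C2R2 \o a m)
  (\prod_(k < m) c k * fine (P (cyl J A))) (mcyl J mA)
  mG G0 (mX m).
under eq_integral do rewrite big_ord_recr EFinM.
rewrite /= (H _ (fun z => (f m z)%:E))//.
- by rewrite fc big_ord_recr/= -!EFinM -[in RHS](fineK (fin J A mA)) -EFinM mulrAC.
- move=> A0 mA0.
  (* The event on [a m] becomes one more condition of the cylinder. As [m] is not in [J], no earlier
     condition is overwritten. *)
  pose A' j := if j == m then A0 else A j.
  have mA' j : measurable (A' j) by rewrite /A'; case: ifP => _; [exact: mA0|exact: mA].
  have mJ : m \notin J by apply/negP => /Jm; rewrite ltnn.
  have -> : cyl J A `&` (C2R2 \o a m) @^-1` A0 = cyl (m |` J)%fset A'.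
    apply/seteqP; split => w.
      move=> [wJ wm] j /=; rewrite in_fset1U /A'; case: eqP => [-> //|_ /= jJ].
      exact: wJ.
    move=> wJ; split; last first.
      by have := wJ m; rewrite /= /A' eqxx fset1U1; exact.
    move=> j /= jJ; have := wJ j; rewrite /= in_fset1U jJ orbT /A' => /(_ isT).
    by case: eqP => // jm; move: mJ; rewrite -jm jJ.
  rewrite IH//; last first.
    by move=> j; rewrite in_fset1U => /orP[/eqP -> //|/Jm /ltnW].
  rewrite EFinM fineK ?fin// -muleA; congr (_ * _)%E.
  rewrite /cyl !hind// big_fsetU1//= muleC; congr (_ * _)%E.
    apply: eq_big_seq => j jJ; rewrite /A'.
    by case: eqP => // jm; move: mJ; rewrite -jm jJ.
  by rewrite /A' eqxx; have [_ hm] := ha m; exact: hm.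
- by apply/measurable_EFinP; exact: mf.
- by move=> z; rewrite lee_fin.
Qed.

Lemma gaussian_sum_mgf (l : R[i]) (u : nat -> R[i]) n :
  (\int[P]_w (expR (complex.Re (l * \sum_(k < n) a k w * u k)))%:E)%E =
  (expR (cmod l ^+ 2 * (\sum_(k < n) cmod (u k) ^+ 2) / 4))%:E.
Proof.
pose f k (z : R * R) := expR (complex.Re (l * u k) * z.1 - complex.Im (l * u k) * z.2).
pose c k := expR (cmod (l * u k) ^+ 2 / 4).
have mf k : measurable_fun setT (f k).
  apply: measurableT_comp => //; apply: measurable_funB.
    by apply: measurableT_comp => //; exact: mulrl_measurable.
  by apply: measurableT_comp => //; exact: mulrl_measurable.
have := @integral_indep_prod f c mf (fun k z => expR_ge0 _) (fun k => gauss_mgf _) n fset0 (fun=>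
  setT) (fun=> measurableT).
have -> : cyl fset0 (fun=> setT) = setT.
  by apply/seteqP; split.
rewrite probability_setT mule1 => H.
transitivity (\int[P]_w (\prod_(k < n) f k (C2R2 (a k w)))%:E)%E.
  apply: eq_integral => w _; congr EFin.
  rewrite mulr_sumr (Re_sum _ (fun k => l * (a k w * u k))) expR_sum.
  by apply: eq_bigr => k _; rewrite /f /C2R2/= (mulrC (a k w)) mulrA [in LHS]ReM.
rewrite H//; congr EFin.
rewrite mulr_sumr mulr_suml expR_sum; apply: eq_bigr => k _.
by rewrite /c Normc.normcM exprMn.
Qed.

(** From |v|^q <= s^q q! (exp(v / s) + exp(- v / s)), for v the real and the imaginary part of the
    sum. The four exponentials are generating functions at parameters of modulus 1 / s, each of
    integral at most exp(1 / 4); the factor 2^q comes from splitting the modulus. The constant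
    depends on [q] only. *)
Lemma gaussian_sum_moment (q : nat) : exists2 C : R, 0 < C &
  forall (s : R) (u : nat -> R[i]) n, 0 < s -> \sum_(k < n) cmod (u k) ^+ 2 <= s ^+ 2 ->
  (\int[P]_w ((cmod (\sum_(k < n) a k w * u k)%R) ^+ q)%:E <= (C * s ^+ q)%:E)%E.
Proof.
exists (2 ^+ q * q`!%:R * 4 * expR (1 / 4)).
  by rewrite !mulr_gt0 ?expR_gt0 ?exprn_gt0// ltr0n fact_gt0.
move=> s u n s0 us.
pose S w := \sum_(k < n) a k w * u k.
pose E (l : R[i]) w := expR (complex.Re (l * S w)).
pose D : R := 2 ^+ q * q`!%:R * s ^+ q.
have D0 : 0 <= D by rewrite !mulr_ge0// exprn_ge0// ltW.
have pw w : cmod (S w) ^+ q <= D * (E (s^-1)%:C w + E (- s^-1)%:C w + E (0 +i* - s^-1) w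
  + E (0 +i* s^-1) w).
  set x := complex.Re (S w); set y := complex.Im (S w).
  have -> : E (s^-1)%:C w = expR (x / s) by rewrite /E ReM/= mul0r subr0 mulrC.
  have -> : E (- s^-1)%:C w = expR (- (x / s)) by rewrite /E ReM/= mul0r subr0 mulrC mulrN.
  have -> : E (0 +i* - s^-1) w = expR (y / s).
    by rewrite /E ReM/= mul0r sub0r mulNr opprK mulrC.
  have -> : E (0 +i* s^-1) w = expR (- (y / s)).
    by rewrite /E ReM/= mul0r sub0r mulrC.
  have H (v : R) : `|v| ^+ q <= s ^+ q * q`!%:R * (expR (v / s) + expR (- (v / s))).
    have -> : `|v| = s * (`|v| / s) by rewrite mulrCA divff ?mulr1// gt_eqF.
    have vs : 0 <= `|v| / s by rewrite divr_ge0// ltW.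
    have := expr_fact_le_expR q vs.
    rewrite ler_pdivrMr ?ltr0n ?fact_gt0// => le; rewrite (exprMn _ s) -(mulrA (s ^+ q)).
    rewrite ler_wpM2l ?exprn_ge0 ?(ltW s0)// (le_trans le)// mulrC ler_wpM2l//.
    by case: (ger0P v) => _; rewrite ?mulNr ?lerDl ?lerDr expR_ge0.
  have m2 : cmod (S w) ^+ q <= 2 ^+ q * (`|x| ^+ q + `|y| ^+ q).
    apply: (@le_trans _ _ ((2 * Num.max `|x| `|y|) ^+ q)).
      rewrite lerXn2r ?nnegrE ?cmod_ge0 ?mulr_ge0 ?le_max ?normr_ge0//.
      rewrite (le_trans (cmod_le_ReIm _))// mulr2n mulrDl mul1r.
      by rewrite lerD// le_max lexx ?orbT.
    rewrite exprMn ler_wpM2l ?exprn_ge0//.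
    by rewrite /Num.max; case: ifP => _; rewrite ?lerDl ?lerDr exprn_ge0.
  apply: (le_trans m2); rewrite /D -!mulrA ler_wpM2l ?exprn_ge0//.
  have := lerD (H x) (H y); rewrite -mulrDr => /le_trans; apply.
  by rewrite !addrA mulrA (mulrC q`!%:R).
have mS : cmeasurable S.
  by apply: (@cmeasurable_sum _ _ _ n (fun k w => a k w * u k)) => k; apply: cmeasurableM;
    [exact: mX|exact: cmeasurable_cst].
have mE l : measurable_fun setT (E l).
  apply: measurableT_comp => //.
  by have /cmeasurableP[] := cmeasurableM (cmeasurable_cst l) mS.
have E0 l w : 0 <= E l w by exact: expR_ge0.
have iE l : cmod l = s^-1 -> (\int[P]_w (E l w)%:E <= (expR (1 / 4))%:E)%E.
  move=> ls; rewrite gaussian_sum_mgf lee_fin ler_expR ls ler_wpM2r ?invr_ge0//.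
  by rewrite exprVn ler_pdivrMl ?exprn_gt0// mulr1.
have iD (f g : Om -> R) : (forall w, 0 <= f w) -> (forall w, 0 <= g w) ->
    measurable_fun setT f -> measurable_fun setT g ->
    (\int[P]_w (f w + g w)%:E = \int[P]_w (f w)%:E + \int[P]_w (g w)%:E)%E.
  move=> f0 g0 mf mg; under eq_integral do rewrite EFinD.
  by rewrite ge0_integralD// => *; rewrite ?lee_fin//; exact/measurable_EFinP.
apply: (@le_trans _ _ (\int[P]_w (D * (E (s^-1)%:C w + E (- s^-1)%:C w + E (0 +i* - s^-1) w
  + E (0 +i* s^-1) w))%:E)%E).
  apply: ge0_le_integral => //.
  - by move=> w _; rewrite lee_fin exprn_ge0// cmod_ge0.
  - by apply/measurable_EFinP; exact: measurable_cmodX.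
  - by apply/measurable_EFinP; apply: measurable_funM => //; do 3!apply: measurable_funD => //.
  - by move=> w _; rewrite lee_fin pw.
under eq_integral do rewrite EFinM.
rewrite ge0_integralZl//; last 2 first.
- by apply/measurable_EFinP; do 3!apply: measurable_funD => //.
- by move=> w _; rewrite lee_fin !addr_ge0.
rewrite !iD//; last 4 first.
- by move=> w; rewrite addr_ge0.
- by apply: measurable_funD.
- by move=> w; rewrite !addr_ge0.
- by do 2!apply: measurable_funD => //.
apply: (@le_trans _ _ (D%:E * ((expR (1 / 4))%:E + (expR (1 / 4))%:E + (expR (1 / 4))%:E
  + (expR (1 / 4))%:E))%E).
  rewrite lee_wpmul2l ?lee_fin// !leeD// iE//.
  - by rewrite cmod_real gtr0_norm ?invr_gt0.
  - by rewrite cmod_real normrN gtr0_norm ?invr_gt0.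
  - by rewrite cmodE/= expr0n/= add0r sqrrN sqrtr_sqr gtr0_norm ?invr_gt0.
  - by rewrite cmodE/= expr0n/= add0r sqrtr_sqr gtr0_norm ?invr_gt0.
rewrite -!EFinD -EFinM lee_fin le_eqVlt; apply/orP; left; apply/eqP; rewrite /D; ring.
Qed.
End independent_gaussians.

(** * Step function approximation *)

Section L2_theory.
Context {R : realType}.
Local Notation mu := (@lebesgue_measure R).
Implicit Types f g s : R -> R[i].

Let mT : measurable [set: measurableTypeR R]. Proof. exact: measurableT. Qed.

Definition sqnorm f : R := \int[mu]_t (cmod (f t) ^+ 2).

Lemma L2_cmeasurable f : L2 f -> @cmeasurable _ (measurableTypeR R) R f.
Proof. by case. Qed.

Lemma L2_integrable f : L2 f ->
  mu.-integrable setT (EFin \o (fun t => cmod (f t) ^+ 2)).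
Proof.
move=> Lf; have mf := L2_cmeasurable Lf; apply/integrableP; split.
  by apply/measurable_EFinP; exact: measurable_cmodX.
have [_] := Lf; congr (_ < _)%E; apply: eq_integral => t _ /=.
by rewrite ger0_norm// exprn_ge0// cmod_ge0.
Qed.

Lemma L2_dom f (phi : R -> R) : @cmeasurable _ (measurableTypeR R) R f ->
  mu.-integrable setT (EFin \o phi) ->
  (forall t, cmod (f t) ^+ 2 <= phi t) -> L2 f.
Proof.
move=> mf /integrableP[mphi iphi] le; split; first exact: mf.
apply: le_lt_trans iphi; apply: ge0_le_integral => //.
- by move=> t _; rewrite lee_fin exprn_ge0// cmod_ge0.
- by apply/measurable_EFinP; exact: measurable_cmodX.
- by apply: measurableT_comp.
- by move=> t _; rewrite lee_fin (le_trans (le t))// ler_norm.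
Qed.

Lemma cmodD_sqr (x y : R[i]) : cmod (x + y) ^+ 2 <= 2 * cmod x ^+ 2 + 2 * cmod y ^+ 2.
Proof.
apply: (@le_trans _ _ ((cmod x + cmod y) ^+ 2)).
  by rewrite lerXn2r ?nnegrE ?addr_ge0 ?cmod_ge0// cmodD.
by have := sqr_ge0 (cmod x - cmod y); rewrite sqrrB sqrrD; lra.
Qed.

Lemma L2D f g : L2 f -> L2 g -> L2 (fun t => f t + g t).
Proof.
move=> Lf Lg; apply: (@L2_dom _ (fun t => 2 * cmod (f t) ^+ 2 + 2 * cmod (g t) ^+ 2)).
- by apply: cmeasurableD; exact: L2_cmeasurable.
- exact: (integrableD mT (integrableZl mT 2 (L2_integrable Lf))
    (integrableZl mT 2 (L2_integrable Lg))).
- by move=> t; exact: cmodD_sqr.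
Qed.

Lemma L2Z (c : R[i]) f : L2 f -> L2 (fun t => c * f t).
Proof.
move=> Lf; apply: (@L2_dom _ (fun t => cmod c ^+ 2 * cmod (f t) ^+ 2)).
- by apply: cmeasurableM; [exact: cmeasurable_cst|exact: L2_cmeasurable].
- exact: (integrableZl mT (cmod c ^+ 2) (L2_integrable Lf)).
- by move=> t; rewrite Normc.normcM exprMn.
Qed.

Lemma L2B f g : L2 f -> L2 g -> L2 (fun t => f t - g t).
Proof.
move=> Lf Lg; rewrite (_ : (fun t => _) = fun t => f t + (- 1) * g t).
  by apply: L2D => //; exact: L2Z.
by apply/funext => t; rewrite mulN1r.
Qed.

Lemma L2_0 : L2 (fun _ : R => 0 : R[i]).
Proof.
apply: (@L2_dom _ (fun=> 0)); first exact: cmeasurable_cst.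
  exact: integrable0.
by move=> t; rewrite Normc.normc0 expr0n.
Qed.

Lemma L2_sum n (F : nat -> R -> R[i]) : (forall k, L2 (F k)) ->
  L2 (fun t => \sum_(k < n) F k t).
Proof.
move=> LF; elim: n => [|n IH].
  by rewrite (_ : (fun t => _) = fun=> 0); [exact: L2_0|apply/funext => t; rewrite big_ord0].
rewrite (_ : (fun t => _) = fun t => \sum_(k < n) F k t + F n t); first exact: L2D.
by apply/funext => t; rewrite big_ord_recr.
Qed.

Lemma L2_inner f g : L2 f -> L2 g -> cintegrable mu setT (fun t => f t * conjc (g t)).
Proof.
move=> Lf Lg.
have /cmeasurableP[m1 m2] := cmeasurableM (L2_cmeasurable Lf) (cmeasurable_conj (L2_cmeasurable
  Lg)).
apply: (cintegrable_dom mT (phi := fun t => cmod (f t) ^+ 2 + cmod (g t) ^+ 2)) => //.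
- exact: (integrableD mT (L2_integrable Lf) (L2_integrable Lg)).
- move=> t _; rewrite Normc.normcM cmod_conj.
  have := sqr_ge0 (cmod (f t) - cmod (g t)); have := cmod_ge0 (f t); have := cmod_ge0 (g t).
  by rewrite sqrrB => *; nra.
Qed.

Lemma innerD f g s : L2 f -> L2 g -> L2 s ->
  inner (fun t => f t + g t) s = inner f s + inner g s.
Proof.
move=> Lf Lg Ls; rewrite /inner -cintegralD//; try exact: L2_inner.
by apply: eq_cintegral => t _; rewrite mulrDl.
Qed.

Lemma innerZ (c : R[i]) f s : L2 f -> L2 s ->
  inner (fun t => c * f t) s = c * inner f s.
Proof.
move=> Lf Ls; rewrite /inner -cintegralZ//; last exact: L2_inner.
by apply: eq_cintegral => t _; rewrite mulrA.
Qed.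

Lemma innerB f g s : L2 f -> L2 g -> L2 s ->
  inner (fun t => f t - g t) s = inner f s - inner g s.
Proof.
move=> Lf Lg Ls; rewrite -[X in _ - X]mul1r -mulNr -innerZ// -innerD//; last exact: L2Z.
by congr inner; apply/funext => t; rewrite mulN1r.
Qed.

Lemma inner0 s : inner (fun=> 0) s = 0.
Proof.
rewrite /inner (_ : (fun t => _) = fun=> 0); last by apply/funext => t; rewrite mul0r.
by rewrite /cintegral /Rintegral/= integral0.
Qed.

Lemma inner_sum n (F : nat -> R -> R[i]) s : (forall k, L2 (F k)) -> L2 s ->
  inner (fun t => \sum_(k < n) F k t) s = \sum_(k < n) inner (F k) s.
Proof.
move=> LF Ls; elim: n => [|n IH].
  rewrite big_ord0 (_ : (fun t => _) = fun=> 0) ?inner0//.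
  by apply/funext => t; rewrite big_ord0.
rewrite big_ord_recr/= -IH -innerD//; last exact: L2_sum.
by congr inner; apply/funext => t; rewrite big_ord_recr.
Qed.

Lemma conjcB (x y : R[i]) : conjc (x - y) = conjc x - conjc y.
Proof. exact: rmorphB. Qed.

Lemma conjcM (x y : R[i]) : conjc (x * y) = conjc x * conjc y.
Proof. exact: rmorphM. Qed.

Lemma inner_conj f g : L2 f -> L2 g -> inner g f = conjc (inner f g).
Proof.
move=> Lf Lg; have [_ iI] := L2_inner Lf Lg.
rewrite /inner /cintegral; apply: complexP => /=.
  by apply: eq_Rintegral => t _; case: (f t) => ? ?; case: (g t) => ? ? /=; ring.
rewrite -mulN1r -RintegralZl//; apply: eq_Rintegral => t _.
by case: (f t) => ? ?; case: (g t) => ? ? /=; ring.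
Qed.

Lemma inner_self f : L2 f -> inner f f = (sqnorm f)%:C.
Proof.
move=> Lf; apply: complexP => /=.
  by apply: eq_Rintegral => t _; rewrite cmod_sqr; case: (f t) => ? ? /=; ring.
rewrite /Rintegral (_ : (fun x => _) = cst 0%E) ?integral0//.
by apply/funext => t; case: (f t) => ? ? /=; congr EFin; ring.
Qed.

Lemma sqnorm_ge0 f : 0 <= sqnorm f.
Proof. by apply: Rintegral_ge0 => t _; rewrite exprn_ge0// cmod_ge0. Qed.

(** The squared norm of the residual [r m] is, by induction, the difference of the two sides. One
    more projection removes exactly |c|^2 because, by [re], the coefficient of [r m] along [e m] is
    still that of [f]. *)
Lemma bessel (e : nat -> R -> R[i]) f n : (forall k, L2 (e k)) ->
  (forall j k, inner (e j) (e k) = (j == k)%:R) -> L2 f ->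
  \sum_(k < n) cmod (inner f (e k)) ^+ 2 <= sqnorm f.
Proof.
move=> Le eo Lf.
pose r n t := f t - \sum_(k < n) inner f (e k) * e k t.
have Lz k : L2 (fun t => inner f (e k) * e k t) by exact: L2Z.
have Ls m : L2 (fun t => \sum_(k < m) inner f (e k) * e k t) := L2_sum m Lz.
have Lr m : L2 (r m) by exact: L2B.
have re m k : (m <= k)%N -> inner (r m) (e k) = inner f (e k).
  move=> mk; rewrite /r innerB//.
  rewrite (inner_sum _ Lz)// big1 ?subr0// => j _.
  rewrite innerZ// eo; case: eqP => [jk|]; last by rewrite mulr0.
  by have := ltn_ord j; rewrite jk ltnNge mk.
suff H m : inner (r m) (r m) = (sqnorm f - \sum_(k < m) cmod (inner f (e k)) ^+ 2)%:C.
  have := H n; rewrite inner_self// => -[] /(congr1 (fun x => 0 <= x)).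
  by rewrite sqnorm_ge0 subr_ge0 => <-.
elim: m => [|m IH].
  rewrite big_ord0 subr0 -inner_self//; congr inner;
    by apply/funext => t; rewrite /r big_ord0 subr0.
have rS : r m.+1 = fun t => r m t - inner f (e m) * e m t.
  by apply/funext => t; rewrite /r big_ord_recr/= opprD addrA.
set c := inner f (e m).
have rm : inner (r m) (e m) = c by rewrite re.
have h1 : inner (r m.+1) (r m.+1) = inner (r m) (r m.+1) - c * inner (e m) (r m.+1).
  by rewrite {1}rS innerB// innerZ.
have h2 : inner (r m) (r m.+1) = inner (r m) (r m) - conjc c * c.
  rewrite (inner_conj (Lr m.+1) (Lr m)) rS innerB// innerZ// conjcB conjcM.
  by rewrite -(inner_conj (Lr m) (Lr m)) -(inner_conj (Le m) (Lr m)) rm.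
have h3 : inner (e m) (r m.+1) = conjc c - conjc c.
  rewrite (inner_conj (Lr m.+1) (Le m)) rS innerB// innerZ// eo eqxx mulr1 rm.
  by rewrite subrr rmorph0 subrr.
rewrite h1 h2 h3 subrr mulr0 subr0 IH big_ord_recr/=.
rewrite (_ : conjc c * c = (cmod c ^+ 2)%:C).
  by apply: complexP => /=; ring.
by apply: complexP; rewrite ?cmod_sqr; case: c {rm h1 h2 h3} => ? ? /=; ring.
Qed.
End L2_theory.

(** * Tail integral of the squared decay *)

Section inverse_square_tail.
Context {R : realType}.
Local Notation mu := (@lebesgue_measure R).

Lemma integral_inv_sqr (T : R) : 0 <= T ->
  (\int[mu]_(t in `[T, +oo[) ((1 + t) ^- 2)%:E = ((1 + T)^-1)%:E)%E.
Proof.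
move=> T0; pose F (t : R) := - (1 + t)^-1.
have dF (x : R) : T <= x -> is_derive x (1 : R) F ((1 + x) ^- 2).
  move=> Tx; have x1 : (cst 1 + id : R -> R) x != 0.
    by rewrite fctE gt_eqF// ltr_pwDl// (le_trans T0).
  have d1 : is_derive x (1 : R) (cst 1 + id : R -> R) 1.
    by apply: is_derive_eq; rewrite add0r.
  have := @is_deriveV R (cst 1 + id) x 1 1 x1 d1.
  move=> d2; have := is_deriveN d2.
  rewrite /GRing.scale/= mulr1 opprK.
  by [].
have -> : ((1 + T)^-1)%:E = (0%:E - (F T)%:E)%E by rewrite /F -EFinB sub0r opprK.
apply: ge0_continuous_FTC2y.
- by move=> x Tx; rewrite invr_ge0 exprn_ge0// addr_ge0// (le_trans T0).
- apply: continuous_in_subspaceT => x /set_mem/=; rewrite in_itv/= andbT => Tx.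
  apply: cvgV; first by rewrite expf_neq0// gt_eqF// ltr_pwDl// (le_trans T0).
  have c1 : (1 + x0) @[x0 --> x] --> 1 + x by apply: cvgD; [exact: cvg_cst|exact: cvg_id].
  rewrite expr2; under eq_fun do rewrite expr2.
  exact: cvgM.
- rewrite -oppr0; apply: cvgN; apply/gtr0_cvgV0.
    by near=> x; rewrite ltr_pwDl//.
  exact: cvg_addrl.
- by move=> x /ltW /dF[].
- have [d1 _] := dF T (lexx T).
  apply: cvg_at_right_filter; apply: differentiable_continuous; exact/derivable1_diffP.
- move=> x; rewrite in_itv/= andbT => /ltW /dF ?.
  by rewrite derive1E derive_val.
Unshelve. all: by end_near.
Qed.

Definition decay2 (t : R) := (1 + `|t|) ^- 2.

Lemma decay2_ge0 t : 0 <= decay2 t.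
Proof. by rewrite invr_ge0 exprn_ge0// addr_ge0. Qed.

Lemma measurable_decay2 : measurable_fun [set: measurableTypeR R] decay2.
Proof.
apply: continuous_measurable_fun => x; rewrite /decay2.
have x1 : 1 + `|x| != 0 by rewrite gt_eqF// ltr_pwDl.
apply: cvgV; first by rewrite expf_neq0.
have c1 : (1 + `|x0|) @[x0 --> x] --> 1 + `|x|.
  by apply: cvgD; [exact: cvg_cst|apply: cvg_norm; exact: cvg_id].
rewrite expr2; under eq_fun do rewrite expr2.
exact: cvgM.
Qed.

Lemma measurable_norm_ge (T : R) : measurable ([set t | T <= `|t|] : set (measurableTypeR R)).
Proof.
rewrite -[X in measurable X]setTI (_ : [set t | _] = (fun t : R => `|t|) @^-1` `[T, +oo[%classic).
  exact: normr_measurable.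
by apply/seteqP; split => x /=; rewrite in_itv/= andbT.
Qed.

Lemma integral_decay2_tail (T : R) : 0 <= T ->
  (\int[mu]_t (decay2 t * \1_[set t | T <= `|t|] t)%:E <= (2 / (1 + T))%:E)%E.
Proof.
move=> T0; set A := [set t | _].
have mA : measurable (A : set (measurableTypeR R)) by exact: measurable_norm_ge.
pose f t := (decay2 t * \1_A t)%:E.
have f0 t : (0 <= f t)%E by rewrite lee_fin mulr_ge0// decay2_ge0.
have mf : measurable_fun [set: measurableTypeR R] f.
  apply/measurable_EFinP; apply: measurable_funM; first exact: measurable_decay2.
  exact: measurable_indic.
have fN t : f (- t) = f t.
  rewrite /f /decay2 normrN !indicE (_ : (- t \in A) = (t \in A))//.
  by apply/idP/idP => /set_mem h; apply/mem_set; move: h; rewrite /A/= normrN.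
have sym := ge0_integration_by_substitution0 mf f0.
have half : (\int[mu]_(t in `[0%R, +oo[) f t = ((1 + T)^-1)%:E)%E.
  rewrite -(integral_inv_sqr T0).
  rewrite (_ : `[T, +oo[%classic = `[0%R, +oo[%classic `&` A); last first.
    apply/seteqP; split => x; rewrite /A /= !in_itv/= !andbT.
      by move=> Tx; rewrite ger0_norm (le_trans T0 Tx).
    by move=> [x0]; rewrite ger0_norm.
  rewrite integral_mkcondr epatch_indic; apply: eq_integral => t.
  move=> /set_mem/=; rewrite in_itv/= andbT => t0.
  by rewrite /f /decay2 EFinM ger0_norm.
have -> : (\int[mu]_t f t = \int[mu]_(t in `]-oo, 0%R[) f t + \int[mu]_(t in `[0%R, +oo[) f t)%E.
  rewrite -ge0_integral_setU//=.
  - congr (integral _ _ _); apply/seteqP; split => // x _ /=.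
    by rewrite !in_itv/= andbT; case: (ltP x 0); [left|right].
  - exact: measurable_funS mf.
  - apply/disj_set2P; rewrite -subset0 => x [] /=; rewrite !in_itv/= andbT => x0.
    by rewrite leNgt x0.
(* Closing the interval at 0 can only enlarge the integral, and gives the form on which the
   reflection acts. *)
apply: (@le_trans _ _ (\int[mu]_(t in `]-oo, 0%R]) f t + \int[mu]_(t in `[0%R, +oo[) f t)%E).
  rewrite leeD2r//; apply: ge0_subset_integral => //.
  - exact: measurable_funS mf.
  - by move=> x /=; rewrite !in_itv/=; exact: ltW.
have -> : (\int[mu]_(t in `]-oo, 0%R]) f t = \int[mu]_(t in `[0%R, +oo[) f t)%E.
  by rewrite sym; apply: eq_integral => t _; rewrite fN.
by rewrite half -EFinD lee_fin mulr2n mulrDl mul1r.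
Qed.

Lemma integrable_decay2 : mu.-integrable [set: measurableTypeR R] (EFin \o decay2).
Proof.
apply/integrableP; split; first by apply/measurable_EFinP; exact: measurable_decay2.
apply: (@le_lt_trans _ _ (2 / (1 + 0))%:E); last exact: ltry.
apply: le_trans (integral_decay2_tail (lexx 0)).
rewrite le_eqVlt; apply/orP; left; apply/eqP; apply: eq_integral => t _ /=.
by rewrite ger0_norm ?decay2_ge0// indicE mem_set ?mulr1//=.
Qed.
End inverse_square_tail.

(** * Cells and step functions *)

Section step_approximation.
Context {R : realType}.
Local Notation mu := (@lebesgue_measure R).

(** The numbering is that of [discretized_wavelet_transform], which is convertible to the
    corresponding sum over [sample] and [cell]. *)
Definition cell_index (L k : nat) : int := k%:Z - L%:Z + 1.

Definition sample (T : R) (L k : nat) : R := (cell_index L k)%:~R * T.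

Definition cell (T : R) (L k : nat) (t : R) : R[i] :=
  (\1_(`]((cell_index L k)%:~R - 1) * T, (cell_index L k)%:~R * T[%classic : set R) t)%:C.

(** The noise of this function is the discretization error for [g]. As in the discretized transform,
    a cell carries the value at its right end. *)
Definition step_error (T : R) (L : nat) (g : R -> R[i]) (t : R) : R[i] :=
  \sum_(k < L.*2) g (sample T L k) * cell T L k t - g t.

Variable T : R.
Hypothesis T0 : 0 < T.

Lemma cmeasurable_cell L k : @cmeasurable _ (measurableTypeR R) R (cell T L k).
Proof. by apply: cmeasurable_real; exact: measurable_indic. Qed.

Lemma L2_cell L k : L2 (cell T L k).
Proof.
set A : set R := `]((cell_index L k)%:~R - 1) * T, (cell_index L k)%:~R * T[%classic.
apply: (@L2_dom _ _ (\1_A)).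
- exact: cmeasurable_cell.
- apply/integrableP; split; first by apply/measurable_EFinP; apply: measurable_indic;
  exact: measurable_itv.
  under eq_integral do rewrite /= ger0_norm//.
  rewrite integral_indic//; last exact: measurable_itv.
  rewrite setIT; suff : (mu A < +oo)%E by [].
  by rewrite /A lebesgue_measure_itv; case: ifP => _; exact: ltry.
- move=> t; rewrite /cell cmod_real -/A indicE; case: (t \in A) => /=.
    by rewrite normr1 expr1n.
  by rewrite normr0 expr0n.
Qed.

Lemma cellP L k t : cell T L k t =
  (((cell_index L k)%:~R - 1) * T < t < (cell_index L k)%:~R * T)%R%:R.
Proof.
rewrite /cell indicE; case: (boolP (_ && _)) => H.
  by rewrite mem_set//= in_itv/=.
by rewrite memNset//= in_itv/=; exact/negP.
Qed.

Lemma cell_index_inj L k k' t :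
  ((cell_index L k)%:~R - 1) * T < t < (cell_index L k)%:~R * T ->
  ((cell_index L k')%:~R - 1) * T < t < (cell_index L k')%:~R * T -> k = k'.
Proof.
move=> /andP[h1 h2] /andP[h3 h4].
have := lt_trans h1 h4; have := lt_trans h3 h2.
rewrite !ltr_pM2r// -!(intrD _ _ (-1)) !ltr_int /cell_index; lia.
Qed.

Lemma step_error_cell L g k t : (k < L.*2)%N ->
  ((cell_index L k)%:~R - 1) * T < t < (cell_index L k)%:~R * T ->
  step_error T L g t = g (sample T L k) - g t.
Proof.
move=> kL kt; congr (_ - _).
rewrite (bigD1 (Ordinal kL))//= cellP kt mulr1 big1 ?addr0// => j jk.
rewrite cellP; case: (boolP (_ && _)) => [jt|]; last by rewrite mulr0.
by move: jk; rewrite -val_eqE/= (cell_index_inj jt kt) eqxx.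
Qed.

Lemma step_error_out L g t :
  (forall k, (k < L.*2)%N -> ~~ (((cell_index L k)%:~R - 1) * T < t < (cell_index L k)%:~R * T)) ->
  step_error T L g t = - g t.
Proof.
move=> H; rewrite /step_error big1 ?sub0r// => k _.
by rewrite cellP (negbTE (H k _))//= mulr0.
Qed.

(* The cells are open, so that they miss the grid. *)
Definition grid : set R := \bigcup_n [set n%:R * T; - (n%:R * T)].

Lemma measurable_grid : measurable (grid : set (measurableTypeR R)).
Proof. by apply: bigcup_measurable => n _; apply: measurableU; exact: measurable_set1. Qed.

Lemma grid0 : mu grid = 0%E.
Proof.
apply: countable_lebesgue_measure0; apply: bigcup_countable => // n _.
by apply: finite_set_countable; rewrite finite_setU; split; exact: finite_set1.
Qed.

Lemma cell_cover L t : `|t| < L%:R * T -> ~ grid t ->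
  exists2 k, (k < L.*2)%N & ((cell_index L k)%:~R - 1) * T < t < (cell_index L k)%:~R * T.
Proof.
rewrite ltr_norml -mulNr => /andP[h1 h2] tN.
pose m := Num.floor (t / T).
have mt : m%:~R <= t / T by exact: floor_le.
have tm : t / T < (m + 1)%:~R by exact: floorD1_gt.
have mL : (- L%:Z <= m)%R.
  by rewrite -ltzD1 -(ltr_int R) (lt_trans _ tm)// intrN ltr_pdivlMr.
have Lm : (m < L%:Z)%R by rewrite -(ltr_int R) (le_lt_trans mt)// ltr_pdivrMr.
(* The cell containing t is ]m T, (m + 1) T[. Its index is that of its right end, m + 1, which is
   numbered k = m + L. *)
exists (absz (m + L%:Z)); first by rewrite -ltz_nat; lia.
have -> : cell_index L (absz (m + L%:Z)) = m + 1 by rewrite /cell_index; lia.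
apply/andP; split; last by rewrite -ltr_pdivrMr.
rewrite intrD addrK -ltr_pdivlMr// lt_neqAle mt andbT.
apply/eqP => mE; apply: tN.
have tE : t = m%:~R * T by rewrite mE divfK// gt_eqF.
exists (absz m) => //=; rewrite tE.
case: (lerP 0 m) => m0.
  by left; rewrite -[in LHS](gez0_abs m0).
by right; rewrite -mulNr; congr (_ * T); rewrite -[in LHS](opprK m) -(ltz0_abs m0) intrN.
Qed.
End step_approximation.

Section lipschitz_cmeasurable.
Context {R : realType}.

Lemma lipschitz_continuous (C : R) (h : R -> R) : 0 <= C ->
  (forall s t, `|h t - h s| <= C * `|t - s|) -> continuous h.
Proof.
move=> C0 hL x; apply/cvgrPdist_lt => e e0.
have C1 : 0 < C + 1 by rewrite ltr_wpDl.
near=> t; rewrite (le_lt_trans (hL _ _))//.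
apply: (@le_lt_trans _ _ ((C + 1) * `|x - t|)); first by rewrite ler_wpM2r// lerDl.
rewrite mulrC -ltr_pdivlMr//; near: t.
by apply: cvgr_dist_lt; [exact: cvg_id|exact: divr_gt0].
Unshelve. all: by end_near.
Qed.

Lemma lipschitz_cmeasurable (C : R) (g : R -> R[i]) : 0 <= C ->
  (forall s t, cmod (g t - g s) <= C * `|t - s|) ->
  @cmeasurable _ (measurableTypeR R) R g.
Proof.
move=> C0 gL; apply/cmeasurableP; split; apply: continuous_measurable_fun;
  apply: (lipschitz_continuous C0) => s t; apply: le_trans (gL s t).
  by rewrite -ReN -ReD normRe_le_cmod.
by rewrite -ImN -ImD normIm_le_cmod.
Qed.
End lipschitz_cmeasurable.

Section step_error_bound.
Context {R : realType}.
Local Notation mu := (@lebesgue_measure R).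
Variables (T C : R) (L : nat) (g : R -> R[i]).
Hypotheses (T0 : 0 < T) (C0 : 0 <= C).
Hypothesis gC : forall t, cmod (g t) * (1 + `|t|) <= C.
Hypothesis gL : forall s t, cmod (g t - g s) <= C * `|t - s|.

Lemma cmod_sqr_le_decay2 t : cmod (g t) ^+ 2 <= C ^+ 2 * decay2 t.
Proof.
have t1 : 0 < 1 + `|t| by rewrite ltr_pwDl.
rewrite /decay2 ler_pdivlMr ?exprn_gt0// -exprMn lerXn2r// nnegrE.
by rewrite mulr_ge0 ?cmod_ge0// ltW.
Qed.

Lemma decay2_le1 (t : R) : decay2 t <= 1.
Proof.
rewrite /decay2 invf_le1 ?exprn_gt0 ?ltr_pwDl//.
by rewrite exprn_ege1// lerDl.
Qed.

(** On a cell, the Lipschitz bound gives C T. At distance at least L T from 0 the step function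
    vanishes and the decay of [g] remains. The other grid points, missed by the open cells, form a
    null set, where any finite bound will do. *)
Lemma step_error_le t : cmod (step_error T L g t) ^+ 2 <=
  C ^+ 2 * T ^+ 2 * \1_(`[- (L%:R * T), L%:R * T]%classic : set R) t +
  (C ^+ 2 * (decay2 t * \1_[set t | L%:R * T <= `|t|] t) + C ^+ 2 * \1_(@grid R T) t).
Proof.
have C20 : 0 <= C ^+ 2 by rewrite exprn_ge0.
have p1 : 0 <= C ^+ 2 * T ^+ 2 * \1_(`[- (L%:R * T), L%:R * T]%classic : set R) t.
  by rewrite !mulr_ge0 ?exprn_ge0// ltW.
have p2 : 0 <= C ^+ 2 * (decay2 t * \1_[set t | L%:R * T <= `|t|] t).
  by rewrite !mulr_ge0 ?decay2_ge0.
have p3 : 0 <= C ^+ 2 * \1_(@grid R T) t by rewrite mulr_ge0.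
have [[k kL kt]|H] := pselect (exists2 k, (k < L.*2)%N &
    ((cell_index L k)%:~R - 1) * T < t < (cell_index L k)%:~R * T).
  rewrite (step_error_cell T0 g kL kt).
  apply: (@le_trans _ _ (C ^+ 2 * T ^+ 2)).
    rewrite -exprMn lerXn2r ?nnegrE ?cmod_ge0 ?mulr_ge0 ?(ltW T0)//.
    rewrite (le_trans (gL _ _))// ler_wpM2l// ler_norml /sample.
    by move: kt => /andP[]; rewrite mulrBl mul1r; lra.
  rewrite indicE mem_set ?mulr1; last first.
    have kR : k%:R + 1 <= 2 * L%:R :> R by rewrite natr1 -natrM ler_nat mul2n.
    have k0 : 0 <= k%:R :> R by [].
    have ciE : (cell_index L k)%:~R = k%:R - L%:R + 1 :> R by rewrite /cell_index !intrD intrN.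
    move: kt => /andP[h1 h2]; rewrite /= in_itv/=; apply/andP; split.
      by rewrite (le_trans _ (ltW h1))// -mulNr ler_pM2r// ciE; lra.
    by rewrite (le_trans (ltW h2))// ler_pM2r// ciE; lra.
  lra.
have -> : step_error T L g t = - g t.
  by apply: step_error_out => k kL; apply/negP => kt; apply: H; exists k.
rewrite cmodN; have [LT|LT] := leP (L%:R * T) `|t|.
  apply: (le_trans (cmod_sqr_le_decay2 t)).
  move: p2; rewrite [in X in 0 <= X -> _]indicE [X in _
    <= _ + (_ * (_ * X) + _)]indicE mem_set//= mulr1; lra.
have gt : @grid R T t by apply: contrapT => /(cell_cover T0 LT).
apply: (@le_trans _ _ (C ^+ 2)).
  by rewrite (le_trans (cmod_sqr_le_decay2 t))// ler_piMr// decay2_le1.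
move: p3; rewrite [in X in 0 <= X -> _]indicE [X in _ <= _ + (_ + _ * X)]indicE mem_set//= mulr1;
  lra.
Qed.

Let mg : @cmeasurable _ (measurableTypeR R) R g.
Proof. exact: lipschitz_cmeasurable gL. Qed.

Lemma L2_decay : L2 g.
Proof.
apply: (@L2_dom _ _ (fun t => C ^+ 2 * decay2 t)) => //.
- exact: (integrableZl _ (C ^+ 2) (@integrable_decay2 R)).
- exact: cmod_sqr_le_decay2.
Qed.

Lemma L2_step_error : L2 (step_error T L g).
Proof.
apply: L2B; last exact: L2_decay.
by apply: (@L2_sum _ _ (fun k t => g (sample T L k) * cell T L k t)) => k; apply: L2Z;
  exact: L2_cell.
Qed.

(** The window has length 2 L T and carries the squared error C^2 T^2; the tail contributes at most
    2 C^2 / (1 + L T) and the grid nothing. *)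
Lemma sqnorm_step_error :
  sqnorm (step_error T L g) <= C ^+ 2 * (2 * L%:R * T ^+ 3 + 2 / (1 + L%:R * T)).
Proof.
have C20 : 0 <= C ^+ 2 by rewrite exprn_ge0.
have LT0 : 0 <= L%:R * T by rewrite mulr_ge0// ltW.
have mI (A : set R) : measurable (A : set (measurableTypeR R)) ->
  measurable_fun [set: measurableTypeR R] (\1_A : R -> R) by exact: measurable_indic.
have mA : measurable (`[- (L%:R * T), L%:R * T]%classic : set (measurableTypeR R))
  by exact: measurable_itv.
have mB : measurable ([set t | L%:R * T <= `|t|] : set (measurableTypeR R))
  by exact: measurable_norm_ge.
have mG := measurable_grid T.
rewrite -lee_fin /sqnorm fineK; last exact: integrable_fin_num (L2_integrable L2_step_error).
set f1 := fun t => C ^+ 2 * T ^+ 2 * \1_(`[- (L%:R * T), L%:R * T]%classic : set R) t.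
set f2 := fun t => C ^+ 2 * (decay2 t * \1_[set t | L%:R * T <= `|t|] t).
set f3 := fun t => C ^+ 2 * \1_(@grid R T) t.
have m1 : measurable_fun [set: measurableTypeR R] f1 by apply: measurable_funM => //; exact: mI.
have m2 : measurable_fun [set: measurableTypeR R] f2.
  by apply: measurable_funM => //; apply: measurable_funM; [exact: measurable_decay2|exact: mI].
have m3 : measurable_fun [set: measurableTypeR R] f3 by apply: measurable_funM => //; exact: mI.
have p1 t : 0 <= f1 t by rewrite !mulr_ge0 ?exprn_ge0// ltW.
have p2 t : 0 <= f2 t by rewrite !mulr_ge0 ?decay2_ge0.
have p3 t : 0 <= f3 t by rewrite mulr_ge0.
apply: (@le_trans _ _ (\int[mu]_t (f1 t + (f2 t + f3 t))%:E)%E).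
  apply: ge0_le_integral => //.
  - by move=> t _; rewrite lee_fin exprn_ge0// cmod_ge0.
  - apply/measurable_EFinP; apply: measurable_cmodX; exact: L2_cmeasurable L2_step_error.
  - by apply/measurable_EFinP; do 2!apply: measurable_funD => //.
  - by move=> t _; rewrite lee_fin; exact: step_error_le.
under eq_integral do rewrite !EFinD.
rewrite ge0_integralD//; last 4 first.
- by move=> t _; rewrite lee_fin.
- by apply/measurable_EFinP.
- by move=> t _; rewrite -EFinD lee_fin addr_ge0.
- by apply: emeasurable_funD; apply/measurable_EFinP.
rewrite ge0_integralD//; last 4 first.
- by move=> t _; rewrite lee_fin.
- by apply/measurable_EFinP.
- by move=> t _; rewrite lee_fin.
- by apply/measurable_EFinP.
have i1 : (\int[mu]_t (f1 t)%:E = (C ^+ 2 * (2 * L%:R * T ^+ 3))%:E)%E.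
  under eq_integral do rewrite EFinM.
  rewrite ge0_integralZl//; last 2 first.
  - by apply/measurable_EFinP; exact: mI.
  - by rewrite lee_fin mulr_ge0// exprn_ge0// ltW.
  have muA : mu `[- (L%:R * T), L%:R * T]%classic = (2 * L%:R * T)%:E.
    rewrite lebesgue_measure_itv/= lte_fin; case: ifPn => [_|].
      by rewrite -EFinB; congr EFin; ring.
    by rewrite -leNgt => ?; congr EFin; lra.
  rewrite integral_indic// setIT; apply: (etrans (congr1 (mule (C ^+ 2 * T ^+ 2)%:E) muA)).
  by rewrite -EFinM; congr EFin; ring.
have i2 : (\int[mu]_t (f2 t)%:E <= (C ^+ 2 * (2 / (1 + L%:R * T)))%:E)%E.
  under eq_integral do rewrite EFinM.
  rewrite ge0_integralZl//; last 2 first.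
  - by apply/measurable_EFinP; apply: measurable_funM; [exact: measurable_decay2|exact: mI].
  - by move=> t _; rewrite lee_fin mulr_ge0 ?decay2_ge0.
  rewrite (EFinM _ (2 / _)); apply: lee_wpmul2l; first by rewrite lee_fin.
  exact: integral_decay2_tail.
have i3 : (\int[mu]_t (f3 t)%:E = 0)%E.
  under eq_integral do rewrite EFinM.
  rewrite ge0_integralZl//; last by apply/measurable_EFinP; exact: mI.
  rewrite integral_indic// setIT; apply: (etrans (congr1 (mule (C ^+ 2)%:E) (grid0 T))).
  by rewrite mule0.
by rewrite i1 i3 adde0 mulrDr EFinD leeD2l.
Qed.
End step_error_bound.

(** * Almost sure convergence *)

Section fatou_borel_cantelli.
Local Open Scope ereal_scope.

Lemma limn_einf_le {R : realType} (u : nat -> \bar R) (x : \bar R) :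
  (\forall n \near \oo, u n <= x) -> limn_einf u <= x.
Proof.
move=> ux; rewrite limn_einf_lim; apply: lime_le; first exact: is_cvg_einfs.
apply: filterS ux => n; apply: le_trans; apply: ereal_inf_lbound.
by exists n => /=.
Qed.

Lemma limn_einf_lt {R : realType} (u : nat -> \bar R) (x : \bar R) m :
  limn_einf u < x -> exists2 n, (m <= n)%N & u n < x.
Proof.
move=> ux; apply: contrapT => H; move: ux; apply/negP; rewrite -leNgt limn_einf_lim.
apply: lime_ge; first exact: is_cvg_einfs.
exists m => // n /= mn; apply: le_ereal_inf_tmp => _ [k /= nk <-].
by rewrite leNgt; apply/negP => kx; apply: H; exists k => //; exact: leq_trans nk.
Qed.

(* A Borel-Cantelli lemma for the lower limits in [n] of [Q L n]: their integrals
   are at most [b L] by Fatou, hence they are almost surely summable in [L]. *)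
Lemma ae_frequently_small {d} {Om : measurableType d} {R : realType}
    (P : probability Om R) (Q : nat -> nat -> Om -> \bar R) (b : nat -> R) (M : R) :
  (forall L n, measurable_fun setT (Q L n)) -> (forall L n w, 0 <= Q L n w) ->
  (forall L, (0 <= b L)%R) ->
  (forall L (e : R), (0 < e)%R -> \forall n \near \oo, \int[P]_w Q L n w <= (b L + e)%:E) ->
  (forall n, (\sum_(L < n) b L <= M)%R) ->
  {ae P, forall w, forall e : R, (0 < e)%R -> \forall L \near \oo,
    forall m, exists2 n, (m <= n)%N & Q L n w < e%:E}.
Proof.
move=> mQ Q0 b0 Qb bM.
pose Z L w := limn_einf (Q L ^~ w).
have mZ L : measurable_fun setT (Z L).
  apply: measurableT_comp; first exact: oppe_measurable.
  apply: (@measurable_fun_limn_esup _ _ _ _ (fun n w => - Q L n w)) => n.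
  by apply: measurableT_comp; first exact: oppe_measurable.
have Z0 L w : 0 <= Z L w.
  rewrite leNgt; apply/negP => /(limn_einf_lt 0)[n _].
  by rewrite ltNge Q0.
have Zb L : \int[P]_w Z L w <= (b L)%:E.
  apply: (le_trans (fatou _ _ _ _)) => //.
  by apply/lee_addgt0Pr => e e0; apply: limn_einf_le; rewrite -EFinD; exact: Qb.
have sumZ : \int[P]_w (\sum_(0 <= L <oo) Z L w) <= M%:E.
  rewrite integral_nneseries//; apply: lime_le.
    by apply: is_cvg_nneseries => n _ _; exact: integral_ge0.
  apply: nearW => n; rewrite big_mkord.
  apply: (@le_trans _ _ (\sum_(L < n) (b L)%:E)); first exact: lee_sum.
  by rewrite sumEFin lee_fin.
have isum : P.-integrable setT (fun w => \sum_(0 <= L <oo) Z L w).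
  apply/integrableP; split.
    apply: (ge0_emeasurable_sum (P := predT)) => //.
  apply: le_lt_trans (ltry M); apply: le_trans sumZ.
  rewrite le_eqVlt; apply/orP; left; apply/eqP; apply: eq_integral => w _.
  by rewrite gee0_abs// nneseries_ge0.
have := integrable_ae measurableT isum; apply: filterS => w /(_ I) wfin e e0.
have wlt : \sum_(0 <= L <oo) Z L w < +oo by move: wfin; rewrite fin_numE => /andP[_]; rewrite ltey.
(* The tails of a convergent series tend to 0, and the tail from [L] on is at least its first term
   [Z L w]. *)
have := nneseries_tail_cvg wlt (fun k _ => Z0 k w).
move=> /fine_cvgP[fin /cvgrPdist_lt /(_ e e0) small].
near=> L => m; apply: limn_einf_lt; rewrite -/(Z L w).
have tfin : \sum_(L <= k <oo) Z k w \is a fin_num by near: L.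
have tsmall : (`|0 - fine (\sum_(L <= k <oo) Z k w)| < e)%R by near: L.
apply: (@le_lt_trans _ _ (\sum_(L <= k <oo) Z k w)).
  apply: lime_ge; first by apply: is_cvg_nneseries => n _ _; exact: Z0.
  exists L.+1 => // n /= Ln; rewrite big_ltn// leeDl//.
  by apply: sume_ge0 => k _; exact: Z0.
have : (fine (\sum_(L <= k <oo) Z k w) < e)%R.
  by apply: le_lt_trans tsmall; rewrite sub0r normrN ler_norm.
by rewrite -lte_fin fineK.
Unshelve. all: by end_near.
Qed.
End fatou_borel_cantelli.

(** * Partial sums of the noise *)

Section noise_functional.
Context {R : realType} {Om : Type}.
Local Notation mu := (@lebesgue_measure R).
Variables (a : nat -> Om -> R[i]) (e : nat -> R -> R[i]).
Hypothesis Le : forall k, L2 (e k).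
Implicit Types f g : R -> R[i].

Lemma noise_sumZ n (c : R[i]) f w : L2 f ->
  noise_sum a e n (fun t => c * f t) w = c * noise_sum a e n f w.
Proof.
by move=> Lf; rewrite mulr_sumr; apply: eq_bigr => k _; rewrite innerZ// mulrCA.
Qed.

Lemma noise_sum_sum n m (F : nat -> R -> R[i]) w : (forall k, L2 (F k)) ->
  noise_sum a e n (fun t => \sum_(k < m) F k t) w = \sum_(k < m) noise_sum a e n (F k) w.
Proof.
move=> LF; rewrite /noise_sum exchange_big/=; apply: eq_bigr => j _.
by rewrite inner_sum// mulr_sumr.
Qed.

Lemma noise_sumB n f g w : L2 f -> L2 g ->
  noise_sum a e n (fun t => f t - g t) w = noise_sum a e n f w - noise_sum a e n g w.
Proof.
by move=> Lf Lg; rewrite -sumrB; apply: eq_bigr => k _; rewrite innerB// mulrBr.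
Qed.

Definition noise_bound n w : R :=
  \sum_(k < n) cmod (a k w) * (2 * \int[mu]_t (decay2 t + cmod (e k t) ^+ 2)).

(* The constant is random and depends on [n], but it does not involve [g]: it
   absorbs the remainder of the expansion of the atom, [n] being fixed. *)
Lemma noise_sum_le n w (C : R) g : 0 <= C -> L2 g ->
  (forall t, cmod (g t) * (1 + `|t|) <= C) ->
  cmod (noise_sum a e n g w) <= C * noise_bound n w.
Proof.
move=> C0 Lg gC; rewrite (le_trans (cmod_sum n (fun k => a k w * inner g (e k))))//.
rewrite /noise_bound mulr_sumr; apply: ler_sum => k _.
rewrite Normc.normcM mulrCA ler_wpM2l ?cmod_ge0//.
have mT : measurable [set: measurableTypeR R] by exact: measurableT.
have iphi : mu.-integrable setT (EFin \o (fun t => decay2 t + cmod (e k t) ^+ 2)).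
  exact: (integrableD mT (@integrable_decay2 R) (L2_integrable (Le k))).
rewrite mulrCA -RintegralZl//; apply: cmod_cintegral_le => //.
- exact: L2_inner.
- exact: (integrableZl mT C iphi).
- move=> t _; rewrite Normc.normcM cmod_conj.
  have t1 : 0 < 1 + `|t| by rewrite ltr_pwDl.
  have gle : cmod (g t) <= C * (1 + `|t|)^-1 by rewrite ler_pdivlMr.
  apply: (le_trans (ler_wpM2r (cmod_ge0 _) gle)); rewrite -mulrA ler_wpM2l//.
  rewrite /decay2 -exprVn; set u := _^-1; set v := cmod _.
  have u0 : 0 <= u by rewrite invr_ge0 ltW.
  have v0 : 0 <= v by exact: cmod_ge0.
  have := sqr_ge0 (u - v); rewrite sqrrB; nra.
Qed.

Lemma noise_sum_step_error n (T : R) L g w : L2 g ->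
  noise_sum a e n (step_error T L g) w =
  \sum_(k < L.*2) g (sample T L k) * noise_sum a e n (cell T L k) w - noise_sum a e n g w.
Proof.
move=> Lg.
have Lc k : L2 (fun t => g (sample T L k) * cell T L k t) by apply: L2Z; exact: L2_cell.
rewrite noise_sumB//; last exact: (L2_sum _ Lc).
rewrite (noise_sum_sum _ _ _ Lc); congr (_ - _); apply: eq_bigr => k _.
by rewrite noise_sumZ//; exact: L2_cell.
Qed.
End noise_functional.

Section pointwise_bound.
Context {R : realType} {Om : Type}.
Variables (a : nat -> Om -> R[i]) (e : nat -> R -> R[i]).
Hypothesis Le : forall k, L2 (e k).
Variables (C : R) (g : nat -> R -> R[i]) (f : R -> R[i]) (c : R) (q : R[i]).
Hypothesis C0 : 0 < C.
Hypothesis gC : forall k t, cmod (g k t) * (1 + `|t|) <= C.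
Hypothesis gL : forall k s t, cmod (g k t - g k s) <= C * `|t - s|.
Hypotheses (cC : 0 <= c <= C) (q2 : cmod q <= 1 / 2).
Hypothesis fg : forall K t,
  cmod (f t - c%:C * \sum_(k < K) q ^+ k * g k t) * (1 + `|t|) <= C * (1 / 2) ^+ K.

Let c0 : 0 <= c. Proof. by case/andP: cC. Qed.

Let qk k : cmod (q ^+ k) <= (1 / 2) ^+ k.
Proof. by rewrite cmod_exp lerXn2r ?nnegrE ?cmod_ge0. Qed.

Lemma expansion_decay t : cmod (f t) * (1 + `|t|) <= C.
Proof. by have := fg 0 t; rewrite big_ord0 mulr0 subr0 expr0 mulr1. Qed.

(** [f] inherits the Lipschitz bound of the [g k], the geometric weights summing to at most 2, while
    the remainders at [s] and [t] vanish as [K] grows. Through this bound [f] is known to be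
    measurable, hence in L^2. *)
Lemma expansion_lip s t : cmod (f t - f s) <= C * (2 * C) * `|t - s|.
Proof.
apply: (@ler_half_exp _ _ _ (2 * C)) => K.
pose S t := c%:C * \sum_(k < K) q ^+ k * g k t.
have rle u : cmod (f u - S u) <= C * (1 / 2) ^+ K.
  apply: le_trans (fg K u); rewrite ler_peMr ?cmod_ge0//.
  by rewrite lerDl.
have Sle : cmod (S t - S s) <= C * (2 * C) * `|t - s|.
  rewrite /S -mulrBr -sumrB Normc.normcM cmod_real (ger0_norm c0) -!mulrA.
  apply: ler_pM => //; first exact: cmod_ge0.
    by case/andP: cC.
  have -> : \sum_(k < K) (q ^+ k * g k t - q ^+ k * g k s) =
      \sum_(k < K) q ^+ k * (g k t - g k s).
    by apply: eq_bigr => k _; rewrite mulrBr.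
  apply: (le_trans (cmod_sum K (fun k => q ^+ k * (g k t - g k s)))).
  apply: (@le_trans _ _ (\sum_(k < K) (1 / 2) ^+ k * (C * `|t - s|))).
    apply: ler_sum => k _; rewrite Normc.normcM; by apply: ler_pM; rewrite ?cmod_ge0.
  rewrite -mulr_suml ler_wpM2r ?mulr_ge0 ?(ltW C0)//.
  by have := @sum_half_exp R 0 K; rewrite expr0 mulr1.
have -> : f t - f s = (S t - S s) + ((f t - S t) - (f s - S s)) by ring.
apply: (le_trans (cmodD _ _)); apply: lerD => //.
apply: (le_trans (cmodD _ _)); rewrite cmodN.
by have := rle t; have := rle s; lra.
Qed.

Let L2g k : L2 (g k).
Proof. exact: (L2_decay (ltW C0) (gC k) (gL k)). Qed.

Let L2f : L2 f.
Proof.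
apply: (@L2_dom _ _ (fun t => C ^+ 2 * decay2 t)).
- by apply: (lipschitz_cmeasurable _ expansion_lip); rewrite !mulr_ge0// ltW.
- exact: (integrableZl _ (C ^+ 2) (@integrable_decay2 R)).
- exact: cmod_sqr_le_decay2 (ltW C0) expansion_decay.
Qed.

(* From [b <= eps + eps ^- r * b ^+ r.+1]. *)
Lemma pointwise_noise_bound n w T L r (eps S : R) : 0 < eps ->
  (forall K, \sum_(k < K) (1 / 2) ^+ k * cmod (noise_sum a e n (step_error T L (g k)) w) ^+ r.+1
    <= S) ->
  cmod (\sum_(k < L.*2) f (sample T L k) * noise_sum a e n (cell T L k) w -
    noise_sum a e n f w) <= C * (2 * eps + eps ^- r * S).
Proof.
move=> eps0 HS.
pose NE h := \sum_(k < L.*2) h (sample T L k) * noise_sum a e n (cell T L k) w -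
  noise_sum a e n h w.
(* [B] depends on the outcome, on [n] and on [L], but not on [K]. The remainder [h] therefore
   contributes a multiple of (1/2)^K and disappears in the limit. *)
pose B := \sum_(k < L.*2) cmod (noise_sum a e n (cell T L k) w) + noise_bound a e n w.
apply: (@ler_half_exp _ _ _ (C * B)) => K.
pose G t := c%:C * \sum_(k < K) q ^+ k * g k t.
pose h t := f t - G t.
have Lqg k : L2 (fun t => q ^+ k * g k t) by exact: L2Z.
have LG : L2 G by apply: L2Z; exact: (L2_sum _ Lqg).
have Lh : L2 h by exact: L2B.
have NEG : NE G = c%:C * \sum_(k < K) q ^+ k * NE (g k).
  rewrite /NE /G noise_sumZ//; last exact: (L2_sum _ Lqg).
  rewrite (@noise_sum_sum _ _ a e Le n K _ w Lqg).
  under eq_bigr do rewrite -mulrA mulr_suml.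
  rewrite -mulr_sumr -mulrBr exchange_big/= -sumrB; congr (_ * _).
  apply: eq_bigr => k _; rewrite noise_sumZ// mulrBr; congr (_ - _).
  by rewrite [RHS]mulr_sumr; apply: eq_bigr => j _; rewrite mulrA.
have NEf : NE f = NE G + NE h.
  rewrite /NE /h noise_sumB// (eq_bigr (fun k : 'I_(L.*2) => G (sample T L k) * noise_sum a e n
    (cell T L k) w +
    (f (sample T L k) - G (sample T L k)) * noise_sum a e n (cell T L k) w)).
    by rewrite big_split/=; ring.
  by move=> k _; ring.
rewrite -/(NE f) NEf; apply: (le_trans (cmodD _ _)); apply: lerD.
  rewrite NEG Normc.normcM cmod_real (ger0_norm c0).
  apply: ler_pM => //; first exact: cmod_ge0.
    by case/andP: cC.
  apply: (le_trans (cmod_sum K (fun k => q ^+ k * NE (g k)))).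
  apply: (@le_trans _ _ (\sum_(k < K) ((1 / 2) ^+ k * eps +
     eps ^- r * ((1 / 2) ^+ k * cmod (noise_sum a e n (step_error T L (g k)) w) ^+ r.+1)))).
    apply: ler_sum => k _; rewrite Normc.normcM.
    rewrite noise_sum_step_error// -/(NE (g k)); set b := cmod (NE _).
    have b0 : 0 <= b by exact: cmod_ge0.
    apply: (@le_trans _ _ ((1 / 2) ^+ k * b)); first by rewrite ler_wpM2r.
    rewrite mulrCA -mulrDr ler_wpM2l ?exprn_ge0//.
    have [be|be] := leP b eps.
      by rewrite (le_trans be)// lerDl mulr_ge0 ?exprn_ge0// invr_ge0 exprn_ge0// ltW.
    rewrite (le_trans (_ : _ <= eps ^- r * b ^+ r.+1))//; last by rewrite lerDr ltW.
    rewrite exprSr mulrA ler_peMl// mulrC ler_pdivlMr ?exprn_gt0// mul1r.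
    by rewrite lerXn2r ?nnegrE ?(ltW eps0)// ltW.
  rewrite big_split/= -mulr_suml -mulr_sumr; apply: lerD.
    by rewrite ler_wpM2r ?(ltW eps0)//; have := @sum_half_exp R 0 K; rewrite expr0 mulr1.
  by apply: ler_wpM2l; [rewrite invr_ge0 exprn_ge0// ltW|exact: HS].
have hC t : cmod (h t) * (1 + `|t|) <= C * (1 / 2) ^+ K by exact: fg.
have CK : 0 <= C * (1 / 2) ^+ K by rewrite mulr_ge0 ?exprn_ge0// ltW.
rewrite mulrAC /B mulrDr; apply: (le_trans (cmodD _ _)); rewrite cmodN; apply: lerD.
  apply: (le_trans (cmod_sum _ (fun k => h (sample T L k) * noise_sum a e n (cell T L k) w))).
  rewrite mulr_sumr; apply: ler_sum => k _; rewrite Normc.normcM ler_wpM2r ?cmod_ge0//.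
  by apply: le_trans (hC (sample T L k)); rewrite ler_peMr ?cmod_ge0// lerDl.
exact: noise_sum_le.
Qed.
End pointwise_bound.

(** * Step size and moment order *)

Section rates.
Context {R : realType}.
Variable alpha : R.
Hypothesis alpha1 : 1 < alpha.

Definition step_size (L : nat) : R := L%:R `^ (- (alpha / (alpha + 2))).

Lemma step_size_gt0 L : (0 < L)%N -> 0 < step_size L.
Proof. by move=> L0; rewrite powR_gt0// ltr0n. Qed.

(** L T^3 and 1 / (L T) are powers of L with exponents - (2 alpha - 2) / (alpha + 2) and - 2 /
    (alpha + 2). Both are negative, the first because alpha > 1, and [gam] keeps the slower rate. *)
Lemma step_size_rate : exists2 gam : R, 0 < gam & forall L, (0 < L)%N ->
  2 * L%:R * step_size L ^+ 3 + 2 / (1 + L%:R * step_size L) <= 4 * L%:R `^ (- gam).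
Proof.
have a1 := alpha1; have a2 : 0 < alpha + 2 by lra.
pose gam := Num.min ((2 * alpha - 2) / (alpha + 2)) (2 / (alpha + 2)).
exists gam; first by rewrite lt_min !divr_gt0//; lra.
move=> L L0; set l := L%:R; have l1 : 1 <= l :> R by rewrite ler1n.
have l0 : 0 < l by exact: lt_le_trans l1.
have lN0 : l != 0 by rewrite gt_eqF.
have h1 : l * step_size L ^+ 3 <= l `^ (- gam).
  rewrite /step_size -/l -powR_mulrn ?powR_ge0// -powRrM -{1}(powRr1 (ltW l0)) -powRD;
    last by rewrite lN0 implybT.
  rewrite ler_powR//.
  have -> : 1 + - (alpha / (alpha + 2)) * 3 = - ((2 * alpha - 2) / (alpha + 2)).
    by field; rewrite gt_eqF.
  by rewrite lerN2 ge_min lexx.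
have h2 : (1 + l * step_size L)^-1 <= l `^ (- gam).
  apply: (@le_trans _ _ (l * step_size L)^-1).
    by rewrite lef_pV2 ?posrE ?ltr_wpDl ?addr_gt0 ?mulr_gt0 ?step_size_gt0// lerDr.
  rewrite /step_size -/l -{1}(powRr1 (ltW l0)) -powRD; last by rewrite lN0 implybT.
  rewrite -powRN ler_powR//.
  have -> : - (1 + - (alpha / (alpha + 2))) = - (2 / (alpha + 2)).
    by field; rewrite gt_eqF.
  by rewrite lerN2 ge_min lexx orbT.
by rewrite -mulrA; lra.
Qed.
End rates.

Lemma sum_inv_sqr_le {R : realType} n : \sum_(L < n) (L.+1%:R ^- 2 : R) <= 2.
Proof.
(* This sharper bound telescopes: 2 / x - 2 / (x + 1) is at least 1 / x^2 for x >= 1. *)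
suff : \sum_(L < n) (L.+1%:R ^- 2 : R) <= 2 - 2 / n.+1%:R.
  by move=> /le_trans; apply; rewrite lerBlDr lerDl divr_ge0.
elim: n => [|n IH]; first by rewrite big_ord0 divr1 subrr.
rewrite big_ord_recr/= (le_trans (lerD IH (lexx _)))//.
have n1 : 0 < n.+1%:R :> R by rewrite ltr0n.
have -> : n.+2%:R = n.+1%:R + 1 :> R by rewrite natr1.
set x := n.+1%:R in n1 *.
have x1 : 1 <= x by rewrite ler1n.
rewrite -subr_ge0.
have -> : 2 - 2 / (x + 1) - (2 - 2 / x + x ^- 2) = (x - 1) / (x ^+ 2 * (x + 1)).
  by field; rewrite !gt_eqF//; lra.
by rewrite divr_ge0 ?subr_ge0// mulr_ge0 ?exprn_ge0//; lra.
Qed.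

Lemma near_forall_lt (Q : nat -> nat -> Prop) m :
  (forall k, \forall n \near \oo, Q k n) -> \forall n \near \oo, forall k, (k < m)%N -> Q k n.
Proof.
move=> H; elim: m => [|m IH]; first by apply: nearW.
by apply: filterS2 (H m) IH => n Qm IHn k; rewrite ltnS leq_eqVlt => /orP[/eqP->//|/IHn].
Qed.

Section moment_rate.
Context {d} {Om : measurableType d} {R : realType} (P : probability Om R).
Variables (a : nat -> Om -> R[i]) (e : nat -> R -> R[i]) (alpha : R).
Hypothesis ha : forall n, standard_complex_gaussian P (a n).
Hypothesis hind : mutually_independent P a.
Hypothesis he : orthonormal_basis e.
Hypothesis alpha1 : 1 < alpha.

(** The uniformity of [r] and [M] is the point: the bound is summed over the Taylor coefficients
    [g k] and over [L], and passes to the lower limit in [n]. *)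
Lemma step_error_moment (C : R) : 0 < C -> exists r : nat, exists2 M : R, 0 < M &
  forall (g : R -> R[i]) n L, (0 < L)%N ->
  (forall t, cmod (g t) * (1 + `|t|) <= C) ->
  (forall s t, cmod (g t - g s) <= C * `|t - s|) ->
  (\int[P]_w (cmod (noise_sum a e n (step_error (step_size alpha L) L g) w) ^+ r.+1)%:E <=
   (M * L%:R ^- 2)%:E)%E.
Proof.
move=> C0; have [gam gam0 rate] := step_size_rate alpha1.
(* The moment of order r + 1 is of size L^(- gam (r + 1) / 2), which is at most L^(-2) once gam r >=
   4. *)
have [r rb] : exists r : nat, 4 / gam <= r%:R.
  by exists (Num.Def.archi_bound (4 / gam)); rewrite ltW// archi_boundP// divr_ge0// ltW.
have [M M0 HM] := gaussian_sum_moment ha hind r.+1.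
exists r; exists (M * (2 * C) ^+ r.+1); first by rewrite mulr_gt0// exprn_gt0// mulr_gt0.
move=> g n L L0 gC gL; set T := step_size alpha L; have T0 : 0 < T by exact: step_size_gt0.
have [Le eo _] := he.
have l0 : 0 < L%:R :> R by rewrite ltr0n.
(* [s] is the square root of C^2 times the rate 4 L^(- gam). *)
pose s := 2 * C * L%:R `^ (- gam / 2).
have s0 : 0 < s by rewrite !mulr_gt0// powR_gt0.
have lN0 : L%:R != 0 :> R by rewrite gt_eqF.
have L2s := L2_step_error T L (ltW C0) gC gL.
have ss : \sum_(k < n) cmod (inner (step_error T L g) (e k)) ^+ 2 <= s ^+ 2.
  rewrite (le_trans (bessel n Le eo L2s))//.
  rewrite (le_trans (sqnorm_step_error L T0 (ltW C0) gC gL))//.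
  rewrite (le_trans (ler_wpM2l _ (rate L L0)))//; first by rewrite exprn_ge0// ltW.
  rewrite /s 2!exprMn -(powR_mulrn 2 (powR_ge0 _ _)) -powRrM.
  rewrite (_ : - gam / 2 * 2%:R = - gam); last by rewrite divfK.
  by rewrite le_eqVlt; apply/orP; left; apply/eqP; ring.
have := HM s (fun k => inner (step_error T L g) (e k)) n s0 ss;
  rewrite -/(noise_sum _ _ _ _ _) => /le_trans; apply.
rewrite lee_fin /s exprMn mulrA; apply: ler_wpM2l.
  by rewrite mulr_ge0 ?exprn_ge0 ?mulr_ge0// ltW.
rewrite -powR_mulrn ?powR_ge0// -powRrM -(powR_mulrn 2 (ltW l0)) -powRN ler_powR ?ler1n//.
have : 4 <= r%:R * gam by rewrite -ler_pdivrMr.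
rewrite -natr1; nra.
Qed.
End moment_rate.

Lemma cvge0_near_le {R : realType} (u : nat -> \bar R) (x : R) :
  u n @[n --> \oo] --> 0%E -> 0 < x -> \forall n \near \oo, (u n <= x%:E)%E.
Proof.
move=> /fine_cvgP[fin /cvgrPdist_lt/(_ x)] H x0.
apply: filterS2 fin (H x0) => n fn; rewrite sub0r normrN => un.
by rewrite -(fineK fn) lee_fin ltW// (le_lt_trans (ler_norm _)).
Qed.

(** Termwise, b <= eps / m + m b^2 / eps by the arithmetic-geometric inequality. The right-hand side
    is linear in the sum of squares, which is what [noise_defect] controls in expectation. *)
Lemma sum_sqr_ler {R : realType} (m : nat) (b : nat -> R) (eps : R) : 0 < eps ->
  (forall k, 0 <= b k) ->
  \sum_(k < m) b k <= eps + (m%:R * \sum_(k < m) b k ^+ 2) / eps.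
Proof.
move=> eps0 b0; case: m => [|m].
  by rewrite !big_ord0 mulr0 mul0r addr0 ltW.
set l : R := m.+1%:R; have l0 : 0 < l by rewrite ltr0n.
have -> : eps + l * (\sum_(k < m.+1) b k ^+ 2) / eps =
    \sum_(k < m.+1) (eps / l + l * b k ^+ 2 / eps).
  rewrite big_split/= sumr_const card_ord -[(eps / l) *+ _]mulr_natr divfK ?gt_eqF//.
  by congr (_ + _); rewrite mulr_sumr mulr_suml.
apply: ler_sum => k _; rewrite -subr_ge0.
have -> : eps / l + l * b k ^+ 2 / eps - b k =
   ((eps - l * b k) ^+ 2 + eps * (l * b k)) / (l * eps).
  by field; rewrite !gt_eqF.
have l0' := ltW l0; have e0 := ltW eps0.
by rewrite divr_ge0 ?addr_ge0 ?sqr_ge0 ?mulr_ge0.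
Qed.

(** * Convergence on a disc *)

Section disc.
Context {d} {Om : measurableType d} {R : realType} (P : probability Om R).
Variables (a : nat -> Om -> R[i]) (e : nat -> R -> R[i]) (alpha : R).
Variable (N : (R -> R[i]) -> Om -> R[i]).
Hypothesis ha : forall n, standard_complex_gaussian P (a n).
Hypothesis hind : mutually_independent P a.
Hypothesis he : orthonormal_basis e.
Hypothesis hN : white_noise P a e N.
Hypothesis alpha1 : 1 < alpha.

Let cmeasurable_noise_sum n s : cmeasurable (noise_sum a e n s).
Proof.
apply: (@cmeasurable_sum _ _ _ n (fun k w => a k w * inner s (e k))) => k.
by apply: cmeasurableM; [exact: (ha k).1|exact: cmeasurable_cst].
Qed.

(* The factor [L.*2%:R] comes from Cauchy-Schwarz over the [L.*2] cells. *)
Definition noise_defect (L n : nat) (w : Om) : R :=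
  L.*2%:R * \sum_(k < L.*2)
    cmod (noise_sum a e n (cell (step_size alpha L) L k) w - N (cell (step_size alpha L) L k) w)
      ^+ 2.

Lemma noise_defect_ge0 L n w : 0 <= noise_defect L n w.
Proof. by rewrite mulr_ge0// sumr_ge0// => k _; rewrite exprn_ge0// cmod_ge0. Qed.

Let mdefect L n k : measurable_fun [set: Om] (fun w => cmod (noise_sum a e n (cell (step_size
  alpha L) L k) w -
    N (cell (step_size alpha L) L k) w) ^+ 2).
Proof.
apply: measurable_cmodX; apply: cmeasurableB; first exact: cmeasurable_noise_sum.
exact: (hN (L2_cell _ _ _)).1.
Qed.

Lemma measurable_noise_defect L n : measurable_fun [set: Om] (noise_defect L n).
Proof.
apply: measurable_funM; first exact: measurable_cst.
by apply: measurable_sum => k; exact: mdefect.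
Qed.

Lemma noise_defect_cvg0 L eps : 0 < eps ->
  \forall n \near \oo, (\int[P]_w (noise_defect L n w)%:E <= eps%:E)%E.
Proof.
move=> eps0; pose l : R := L.*2%:R.
have l0 : 0 <= l by exact: ler0n.
(* The defect is [l] times a sum of [l] terms, so [l * l] times this bound must not exceed [eps];
   the [+ 1] covers [l = 0]. *)
have x0 : 0 < eps / (l * l + 1) by rewrite divr_gt0// ltr_wpDl// mulr_ge0.
have H k := cvge0_near_le (hN (L2_cell (step_size alpha L) L k)).2 x0.
apply: filterS (near_forall_lt L.*2 H) => n Hn.
under eq_integral do rewrite EFinM -sumEFin.
have m0 k w : (0 <= (cmod (noise_sum a e n (cell (step_size alpha L) L k) w -
    N (cell (step_size alpha L) L k) w) ^+ 2)%:E)%E.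
  by rewrite lee_fin exprn_ge0// cmod_ge0.
rewrite ge0_integralZl//; last 2 first.
- apply: emeasurable_sum => k; apply/measurable_EFinP; exact: mdefect.
- by move=> w _; exact: sume_ge0.
rewrite ge0_integral_sum//; last by move=> k; apply/measurable_EFinP; exact: mdefect.
apply: (@le_trans _ _ (l%:E * \sum_(k < L.*2) (eps / (l * l + 1))%:E)%E).
  by rewrite lee_wpmul2l// lee_sum// => k _; exact: Hn.
rewrite sumEFin -EFinM lee_fin sumr_const card_ord -mulr_natl -/l mulrA mulrCA.
by rewrite ger_pMr// ler_pdivrMr ?mul1r ?lerDl// ltr_wpDl// mulr_ge0.
Qed.

(** [v] stands for the value of the transform at [z], known only as the limit of the partial sums.
    Neither the exceptional set nor the threshold on [L] depends on [z] or [v], which is the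
    uniformity on the disc. The index [L.+1] excludes 0, where [step_error_moment] gives no
    bound. *)
Lemma disc_convergence (z0 : R * R) : 0 < z0.2 ->
  {ae P, forall w, forall eps : R, 0 < eps -> \forall L \near \oo,
    forall (z : R * R) (v : R[i]), `|z.1 - z0.1| <= z0.2 / 16 -> `|z.2 - z0.2| <= z0.2 / 16 ->
    (forall x : R, 0 < x -> \forall n \near \oo,
       cmod (noise_sum a e n (wavelet_atom alpha z) w - v) <= x) ->
    cmod (\sum_(k < L.+1.*2) N (cell (step_size alpha L.+1) L.+1 k) w *
      wavelet_atom alpha z (sample (step_size alpha L.+1) L.+1 k) - v) <= eps}.
Proof.
move=> z00; have [C [g [C0 gC gL Hz]]] := wavelet_atom_expansion alpha1 z00.
have [Le _ _] := he.
have [r [M M0 HM]] := step_error_moment ha hind he alpha1 C0.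
pose F L n k w : R := (1 / 2) ^+ k *
  cmod (noise_sum a e n (step_error (step_size alpha L) L (g k)) w) ^+ r.+1.
have F0 L n k w : (0 <= (F L n k w)%:E)%E.
  by rewrite lee_fin mulr_ge0 ?exprn_ge0// cmod_ge0.
have mF L n k : measurable_fun setT (fun w => (F L n k w)%:E).
  apply/measurable_EFinP; apply: measurable_funM; first exact: measurable_cst.
  exact: measurable_cmodX (cmeasurable_noise_sum _ _).
(* [Q] gathers both random errors: the replacement of [N] by partial sums on the cells, and the
   weighted powers of all the step errors. *)
pose Q L n w := ((noise_defect L.+1 n w)%:E + \sum_(0 <= k <oo) (F L.+1 n k w)%:E)%E.
have msum L n : measurable_fun setT (fun w => \sum_(0 <= k <oo) (F L n k w)%:E)%E.
  by apply: (ge0_emeasurable_sum (P := predT)).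
have mQ L n : measurable_fun setT (Q L n).
  by apply: emeasurable_funD => //; apply/measurable_EFinP; exact: measurable_noise_defect.
have S0 L n w : (0 <= \sum_(0 <= k <oo) (F L n k w)%:E)%E by exact: nneseries_ge0.
have Q0 L n w : (0 <= Q L n w)%E by rewrite adde_ge0// lee_fin noise_defect_ge0.
pose b L : R := 2 * M * L.+1%:R ^- 2.
have b0 L : 0 <= b L by rewrite divr_ge0 ?exprn_ge0// mulr_ge0// ltW.
have Qb L x : 0 < x -> \forall n \near \oo, (\int[P]_w Q L n w <= (b L + x)%:E)%E.
  move=> x0; apply: filterS (noise_defect_cvg0 L.+1 x0) => n Hn.
  rewrite ge0_integralD//; last 2 first.
  - by move=> w _; rewrite lee_fin noise_defect_ge0.
  - by apply/measurable_EFinP; exact: measurable_noise_defect.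
  rewrite addeC EFinD; apply: leeD => //.
  rewrite integral_nneseries//; apply: lime_le.
    by apply: is_cvg_nneseries => k _ _; exact: integral_ge0.
  apply: nearW => K; rewrite big_mkord.
  apply: (@le_trans _ _ (\sum_(k < K) ((1 / 2) ^+ k * (M * L.+1%:R ^- 2))%:E)%E).
    apply: lee_sum => k _; rewrite /F.
    under eq_integral do rewrite EFinM.
    rewrite ge0_integralZl//; last 2 first.
    - by apply/measurable_EFinP; exact: measurable_cmodX (cmeasurable_noise_sum _ _).
    - by move=> w _; rewrite lee_fin exprn_ge0// cmod_ge0.
    by rewrite EFinM lee_wpmul2l ?lee_fin ?exprn_ge0//; exact: HM.
  rewrite sumEFin lee_fin -mulr_suml /b -(mulrA 2) ler_wpM2r//.
    by rewrite divr_ge0 ?exprn_ge0// ltW.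
  by have := @sum_half_exp R 0 K; rewrite expr0 mulr1.
have bM n : \sum_(L < n) b L <= 2 * M * 2.
  rewrite /b -mulr_sumr ler_wpM2l ?sum_inv_sqr_le// mulr_ge0// ltW//.
have := ae_frequently_small mQ Q0 b0 Qb bM; apply: filterS => w Hw eps eps0.
(* Budget: C eps1 = eps / 8 occurs three times, twice from [pointwise_noise_bound] and once from
   [sum_sqr_ler]; the terms in [eta] have total factor C A and cost eps / 4; another eps / 4 is the
   distance from the partial sum to [v]. *)
pose eps1 := eps / (8 * C).
have eps10 : 0 < eps1 by rewrite divr_gt0// mulr_gt0.
pose A := eps1^-1 + eps1 ^- r.
have A0 : 0 < A by rewrite addr_gt0 ?invr_gt0// exprn_gt0.
pose eta := eps / (4 * C * A).
have eta0 : 0 < eta by rewrite divr_gt0// !mulr_gt0.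
apply: filterS (Hw _ eta0) => L {}Hw z v z1 z2 Hv.
have [c [q [cC q2 Hf]]] := Hz z z1 z2.
have eps4 : 0 < eps / 4 by rewrite divr_gt0.
(* [n] may depend on [z]. It is taken beyond the rank [m] after which the partial sums are close to
   [v], which is possible because [Q] is small for arbitrarily large [n]. *)
have [m _ Hm] := Hv _ eps4.
have [n mn Qn] := Hw m.
have := Hm n mn => {Hm} /= nv.
set T := step_size alpha L.+1 in Qn *; set f := wavelet_atom alpha z in Hf nv *.
have dn : noise_defect L.+1 n w <= eta.
  by rewrite -lee_fin (le_trans _ (ltW Qn))// leeDl.
have sn K : \sum_(k < K) F L.+1 n k w <= eta.
  rewrite -lee_fin (le_trans _ (ltW Qn))// -sumEFin -(big_mkord xpredT (fun k => (F L.+1 n k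
    w)%:E)).
  apply: (@le_trans _ _ (\sum_(0 <= k <oo) (F L.+1 n k w)%:E)%E);
    last by rewrite leeDr// lee_fin noise_defect_ge0.
  exact: nneseries_lim_ge.
have fC t : cmod (f t) <= C.
  by apply: le_trans (expansion_decay Hf t); rewrite ler_peMr ?cmod_ge0// lerDl.
have h2 := pointwise_noise_bound Le C0 gC gL cC q2 Hf eps10 sn.
pose D k := noise_sum a e n (cell T L.+1 k) w - N (cell T L.+1 k) w.
have h1 : cmod (\sum_(k < L.+1.*2) f (sample T L.+1 k) * D k) <= C * (eps1 + eta / eps1).
  apply: (le_trans (cmod_sum _ (fun k => f (sample T L.+1 k) * D k))).
  apply: (@le_trans _ _ (C * \sum_(k < L.+1.*2) cmod (D k))).
    by rewrite mulr_sumr; apply: ler_sum => k _; rewrite Normc.normcM ler_wpM2r ?cmod_ge0.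
  rewrite ler_pM2l//; apply: (le_trans (sum_sqr_ler L.+1.*2 eps10 (fun k => cmod_ge0 (D k)))).
  by rewrite lerD2l ler_pM2r ?invr_gt0.
have -> : \sum_(k < L.+1.*2) N (cell T L.+1 k) w * f (sample T L.+1 k) - v =
   ((\sum_(k < L.+1.*2) f (sample T L.+1 k) * noise_sum a e n (cell T L.+1 k) w - noise_sum a e n
     f w)
    - \sum_(k < L.+1.*2) f (sample T L.+1 k) * D k) + (noise_sum a e n f w - v).
  rewrite (eq_bigr (fun k : 'I_(L.+1.*2) => f (sample T L.+1 k) * noise_sum a e n (cell T L.+1 k)
    w - f (sample T L.+1 k) * D k)).
    by rewrite sumrB; ring.
  by move=> k _; rewrite /D; ring.
apply: (le_trans (cmodD _ _)); apply: (le_trans (lerD (cmodD _ _) nv)); rewrite cmodN.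
apply: (le_trans (lerD (lerD h2 h1) (lexx _))).
have e1 : C * eps1 = eps / 8 by rewrite /eps1; field; rewrite gt_eqF.
have e2 : C * (A * eta) = eps / 4 by rewrite /eta; field; rewrite !gt_eqF.
rewrite (_ : C * _ + C * _ = 3 * (C * eps1) + C * (A * eta)); last by rewrite /A; ring.
by rewrite e1 e2; lra.
Qed.
End disc.

(** * From discs to compact sets *)

Lemma sup_cmod_le {T : Type} {R : realType} (D : set T) (f : T -> R[i]) (x : R) :
  0 <= x -> (forall z, D z -> cmod (f z) <= x) -> (sup_cmod D f <= x%:E)%E.
Proof.
move=> x0 fx; rewrite /sup_cmod ge_max lee_fin x0/=.
by apply: ge_ereal_sup => _ [z Dz <-]; rewrite lee_fin fx.
Qed.

Lemma cmod_le_sup {T : Type} {R : realType} (D : set T) (f : T -> R[i]) (x : R) z :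
  (sup_cmod D f <= x%:E)%E -> D z -> cmod (f z) <= x.
Proof.
move=> fx Dz; rewrite -lee_fin (le_trans _ fx)// /sup_cmod le_max.
by apply/orP; right; apply: ereal_sup_ubound; exists z.
Qed.

Lemma sup_cmod_cvg0 {T : Type} {R : realType} (D : set T) (f : nat -> T -> R[i]) :
  (forall x : R, 0 < x -> \forall n \near \oo, forall z, D z -> cmod (f n z) <= x) ->
  sup_cmod D (f n) @[n --> \oo] --> 0%E.
Proof.
move=> H.
have s0 n : (0 <= sup_cmod D (f n))%E by rewrite /sup_cmod le_max lexx.
have Hx x : 0 < x -> \forall n \near \oo, (sup_cmod D (f n) <= x%:E)%E.
  by move=> x0; apply: filterS (H _ x0) => n; exact/sup_cmod_le/ltW.
have fin x n : (sup_cmod D (f n) <= x%:E)%E -> sup_cmod D (f n) \is a fin_num.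
  by move=> h; rewrite ge0_fin_numE// (le_lt_trans h)// ltry.
apply/fine_cvgP; split; first by apply: filterS (Hx 1 ltr01) => n; exact: fin.
apply/cvgrPdist_le => x x0; apply: filterS (Hx x x0) => n h.
by rewrite sub0r normrN ger0_norm ?fine_ge0// -lee_fin fineK//; exact: fin h.
Qed.

Lemma near_inftyS (Q : nat -> Prop) :
  (\forall n \near \oo, Q n.+1) -> \forall n \near \oo, Q n.
Proof. by move=> [m _ H]; exists m.+1 => // -[//|n]; exact: H. Qed.

Lemma ae_filterS_seq {d} {Om : measurableType d} {R : realType} (P : probability Om R)
    {I : choiceType} (s : seq I) (Q : I -> Om -> Prop) :
  (forall i, i \in s -> {ae P, forall w, Q i w}) ->
  {ae P, forall w, forall i, i \in s -> Q i w}.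
Proof.
elim: s => [|i s IH] H; first by apply: aeW.
have hi := H i (mem_head _ _).
have hs : {ae P, forall w, forall j, j \in s -> Q j w}.
  by apply: IH => j js; apply: H; rewrite in_cons js orbT.
apply: filterS2 hi hs => w qi qs j; rewrite in_cons => /orP[/eqP->//|]; exact: qs.
Qed.

Lemma near_seq {I : choiceType} (s : seq I) (Q : I -> nat -> Prop) :
  (forall i, i \in s -> \forall n \near \oo, Q i n) ->
  \forall n \near \oo, forall i, i \in s -> Q i n.
Proof.
elim: s => [|i s IH] H; first exact: nearW.
have hi := H i (mem_head _ _).
have hs : \forall n \near \oo, forall j, j \in s -> Q j n.
  by apply: IH => j js; apply: H; rewrite in_cons js orbT.
apply: filterS2 hi hs => n qi qs j; rewrite in_cons => /orP[/eqP->//|]; exact: qs.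
Qed.

(** The size [z0.2 / 16] is the one allowed in [wavelet_atom_expansion]. Balls of the product are
    boxes, so each coordinate is bounded separately. *)
Lemma finite_disc_cover {R : realType} (D : set (R * R)) : compact D ->
  D `<=` upper_half_plane -> exists2 s : seq (R * R),
    forall z0 : R * R, z0 \in s -> 0 < z0.2 &
    forall z, D z -> exists2 z0, z0 \in s &
      `|z.1 - z0.1| <= z0.2 / 16 /\ `|z.2 - z0.2| <= z0.2 / 16.
Proof.
(* [compact_cover] asks for a pointed topological space; the library does not
   infer that structure on products. *)
move=> cD DP; pose T : ptopologicalType := HB.pack (R * R)%type.
have ccD : cover_compact D.
  by have /(congr1 (fun Q => Q D)) <- := @compact_cover T.
case: (ccD _ D (fun z0 => (ball z0 (z0.2 / 16))°)).
- by move=> z0 _; exact: open_interior.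
- move=> z Dz; exists z => //; apply: nbhsx_ballx.
  by rewrite divr_gt0//; exact: DP.
move=> F FD DF; exists (enum_fset F) => [z0 /FD|z Dz].
  by move=> /set_mem/DP.
have [z0 /= z0F /interior_subset[/= b1 b2]] := DF z Dz; exists z0 => //.
by split; rewrite distrC ltW.
Qed.

Theorem theorem4p1 (R : realType) (d : measure_display)
    (Om : measurableType d) (P : probability Om R)
    (a : nat -> Om -> R[i]) (e : nat -> R -> R[i])
    (N : (R -> R[i]) -> Om -> R[i]) (alpha : R) (W : Om -> R * R -> R[i])
    (ha : forall n, standard_complex_gaussian P (a n))
    (hind : mutually_independent P a)
    (he : orthonormal_basis e)
    (hN : white_noise P a e N)
    (halpha : 1 < alpha)
    (hW : wavelet_transform_of_noise P a e alpha W)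
    (D : set (R * R)) (hD : compact D) (hDP : D `<=` upper_half_plane) :
  {ae P, forall w,
    sup_cmod D (fun z =>
      discretized_wavelet_transform N alpha L
        (L%:R `^ (- (alpha / (alpha + 2)))) w z - W w z)
    @[L --> \oo] --> 0%E}.
Proof.
have [s sP sD] := finite_disc_cover hD hDP.
have [_ _ hWae] := hW.
have disc := ae_filterS_seq (fun z0 z0s => disc_convergence ha hind he hN halpha (sP z0 z0s)).
apply: filterS2 hWae disc => w Ww dw; apply: sup_cmod_cvg0 => x x0; apply: near_inftyS.
have := near_seq (fun z0 z0s => dw z0 z0s x x0); apply: filterS => L H z Dz.
have [z0 z0s [h1 h2]] := sD z Dz.
(* Uniform convergence of the partial sums on [D] identifies [W w z] as their limit at the single
   point [z]. *)
apply: (H z0 z0s z (W w z) h1 h2) => y y0.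
apply: filterS (cvge0_near_le (Ww D hD hDP) y0) => n h.
exact: cmod_le_sup h Dz.
Qed.
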